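(* Let $V$ be a finite-dimensional real normed space, $m\ge 1$ an integer, $p\ge 1$ a real number, and let $\omega$ be a control which is zero only on the diagonal (i.e. $\omega(s,t)>0$ for $s<t$). Then $C^{\omega,p}(G^{m}(V))$, with the metric $d_{\omega,p}$, is complete.
   Context: $T^{(m)}(V)=\bigoplus_{n=0}^{m}V^{\otimes n}$ is the truncated tensor algebra with (truncated) product $\otimes$; $\mathcal{G}^{m}(V)$ is its Lie subalgebra generated by $V$ for the bracket $[a,b]=a\otimes b-b\otimes a$; $G^{m}(V)=\exp(\mathcal{G}^{m}(V))$ is the free nilpotent Lie group of step $m$ over $V$, with product $\otimes$ and neutral element $1$. The dilation is $\delta_{t}(1+v_{1}+\dots+v_{m})=1+tv_{1}+\dots+t^{m}v_{m}$, $v_i\in V^{\otimes i}$, $t\in\mathbb{R}$. $\|\cdot\|_{m}$ is a fixed symmetric subadditive homogeneous norm on $G^{m}(V)$, i.e. a function $G^m(V)\to[0,\infty)$ with $\|g\|_m=0$ iff $g=1$, $\|\delta_t g\|_m=|t|\,\|g\|_m$, $\|g\otimes h\|_m\le\|g\|_m+\|h\|_m$, $\|g^{-1}\|_m=\|g\|_m$ (for instance the Carnot–Caratheodory norm; all such norms are equivalent since $\dim V<\infty$). Set $d_{m}(g,h)=\|g^{-1}\otimes h\|_{m}$. A $G^m(V)$-valued path is a continuous map $[0,1]\to G^{m}(V)$ starting at $1$; for such a path $Y_{s,t}:=Y_{s}^{-1}\otimes Y_{t}$. A control is a continuous function $\omega:\{(s,t):0\le s\le t\le 1\}\to[0,\infty)$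 with $\omega(t,t)=0$ for all $t$ and $\omega(s,t)+\omega(t,u)\le\omega(s,u)$ for $s<t<u$. $d_{\omega,p}(x,y)=\sup_{0\le s<t\le 1}\frac{d_{m}(x_{s,t},y_{s,t})}{\omega(s,t)^{1/p}}$, and $C^{\omega,p}(G^{m}(V))$ is the set of $G^m(V)$-valued paths at finite $d_{\omega,p}$-distance from the constant path $1$. *)

(* Defs.v *)
From HB Require Import structures.
From mathcomp Require Import all_boot all_order all_algebra.
From mathcomp Require Import all_classical all_reals all_analysis.

Set Implicit Arguments.
Unset Strict Implicit.
Unset Printing Implicit Defensive.

Import Order.TTheory GRing.Theory Num.Theory.
Import numFieldNormedType.Exports.

Local Open Scope classical_set_scope.
Local Open Scope ring_scope.

#[short(type="normedVectType")]
HB.structure Definition NormedVector (K : numFieldType) :=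
  {V of NormedModule K V & Vector K V}.

Section Convolution.
Variables (K : fieldType) (I : Type).
Implicit Types (f g h : seq I -> K) (s : seq I).

(* The deconcatenation convolution, that is, the tensor product in
   coordinates on words. *)
Definition wconv f g s : K :=
  \sum_(i < (size s).+1) f (take i s) * g (drop i s).

Lemma wconv_nil f g : wconv f g [::] = f [::] * g [::].
Proof. by rewrite /wconv big_ord_recl big_ord0 addr0. Qed.

Lemma wconv_cons f g x s :
  wconv f g (x :: s) = f [::] * g (x :: s) + wconv (fun s' => f (x :: s')) g s.
Proof. by rewrite /wconv big_ord_recl. Qed.

Lemma eq_wconv f f' g g' s :
    (forall s', size s' <= size s -> f s' = f' s')%N ->
    (forall s', size s' <= size s -> g s' = g' s')%N ->
  wconv f g s = wconv f' g' s.
Proof.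
move=> ef eg; apply: eq_bigr => i _.
by rewrite ef ?eg // ?size_drop ?leq_subr // size_take_min geq_minr.
Qed.

Lemma wconvDl f f' g s :
  wconv (fun s => f s + f' s) g s = wconv f g s + wconv f' g s.
Proof. by rewrite -big_split; apply: eq_bigr => i _; rewrite mulrDl. Qed.

Lemma wconvDr f g g' s :
  wconv f (fun s => g s + g' s) s = wconv f g s + wconv f g' s.
Proof. by rewrite -big_split; apply: eq_bigr => i _; rewrite mulrDr. Qed.

Lemma wconvZl k f g s : wconv (fun s => k * f s) g s = k * wconv f g s.
Proof. by rewrite mulr_sumr; apply: eq_bigr => i _; rewrite mulrA. Qed.

Lemma wconvZr k f g s : wconv f (fun s => k * g s) s = k * wconv f g s.
Proof. by rewrite mulr_sumr; apply: eq_bigr => i _; rewrite mulrCA. Qed.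

Lemma wconv0l g s : wconv (fun=> 0) g s = 0.
Proof. by apply: big1 => i _; rewrite mul0r. Qed.

Lemma wconvA f g h s : wconv f (wconv g h) s = wconv (wconv f g) h s.
Proof.
elim: s f => [|x s IH] f; first by rewrite !wconv_nil mulrA.
rewrite !wconv_cons wconv_nil IH.
have -> : wconv (fun s' => wconv f g (x :: s')) h s =
    wconv (fun s' => f [::] * g (x :: s') +
                    wconv (fun s'' => f (x :: s'')) g s') h s.
  by apply: eq_wconv => // s' _; rewrite wconv_cons.
by rewrite wconvDl wconvZl mulrDr !mulrA !addrA.
Qed.

Lemma wconv1l g s : wconv (fun s => (nilp s)%:R) g s = g s.
Proof.
case: s => [|x s]; first by rewrite wconv_nil mul1r.
by rewrite wconv_cons mul1r (eq_wconv (f' := fun=> 0) (g' := g)) // wconv0l addr0.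
Qed.

Lemma wconv1r f s : wconv f (fun s => (nilp s)%:R) s = f s.
Proof.
elim: s f => [|x s IH] f; first by rewrite wconv_nil mulr1.
by rewrite wconv_cons mulr0 add0r IH.
Qed.

End Convolution.

(* The truncated tensor algebra T^(m)(V), in the basis of V^{(x)n} made of the
   pure tensors e_{i_1} (x) ... (x) e_{i_n}, where e = vbasis {:V}: an element
   is its family of coordinates indexed by the words of length at most m. *)
Definition ttensor (K : fieldType) (V : vectType K) (m : nat) : Type :=
  {ffun m.-bseq 'I_(\dim {:V}) -> K^o}.

HB.instance Definition _ (K : fieldType) (V : vectType K) (m : nat) :=
  GRing.Lmodule.copy (ttensor V m) {ffun m.-bseq 'I_(\dim {:V}) -> K^o}.

Section TruncatedTensorAlgebra.
Variables (K : fieldType) (V : vectType K) (m : nat).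
Notation T := (ttensor V m).
Notation word := (seq 'I_(\dim {:V})).
Implicit Types (a b c : T) (s : word).

Definition tcoef a s : K :=
  if insub s is Some w then (a : {ffun m.-bseq 'I_(\dim {:V}) -> K^o}) w else 0.

Definition mktensor (f : word -> K) : T := [ffun w : m.-bseq _ => f w].

Lemma tcoef_mk f s : tcoef (mktensor f) s = if (size s <= m)%N then f s else 0.
Proof.
by rewrite /tcoef; case: insubP => [w -> <-|/negbTE -> //]; rewrite ffunE.
Qed.

Lemma tcoef_out a s : (m < size s)%N -> tcoef a s = 0.
Proof. by move=> ms; rewrite /tcoef insubN // -ltnNge. Qed.

Lemma tensorP a b :
  (forall s, (size s <= m)%N -> tcoef a s = tcoef b s) <-> a = b.
Proof.
split=> [ab|-> //]; apply/ffunP => w.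
by move: (ab w (size_bseq w)); rewrite /tcoef valK.
Qed.

Lemma tcoef0 s : tcoef 0 s = 0.
Proof. by rewrite /tcoef; case: insubP => // w _ _; rewrite ffunE. Qed.

Lemma tcoefD a b s : tcoef (a + b) s = tcoef a s + tcoef b s.
Proof.
by rewrite /tcoef; case: insubP => [w _ _|_]; rewrite ?ffunE ?addr0.
Qed.

Lemma tcoefZ k a s : tcoef (k *: a) s = k * tcoef a s.
Proof.
by rewrite /tcoef; case: insubP => [w _ _|_]; rewrite ?ffunE ?mulr0.
Qed.

Lemma tcoefN a s : tcoef (- a) s = - tcoef a s.
Proof. by rewrite -scaleN1r tcoefZ mulN1r. Qed.

Definition tone : T := mktensor (fun s => (nilp s)%:R).

Definition tmul a b : T := mktensor (wconv (tcoef a) (tcoef b)).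

Lemma tcoef_one s : tcoef tone s = (nilp s)%:R.
Proof. by rewrite tcoef_mk; case: ifP => //; case: s. Qed.

Lemma tcoef_mul a b s : (size s <= m)%N ->
  tcoef (tmul a b) s = wconv (tcoef a) (tcoef b) s.
Proof. by move=> sm; rewrite tcoef_mk sm. Qed.

Fact tmulA : associative tmul.
Proof.
move=> a b c; apply/tensorP => s sm; rewrite !tcoef_mul //.
rewrite (eq_wconv (f' := tcoef a) (g' := wconv (tcoef b) (tcoef c))) //; last first.
  by move=> s' s's; rewrite tcoef_mul // (leq_trans s's).
rewrite wconvA; apply: eq_wconv => // s' s's.
by rewrite tcoef_mul // (leq_trans s's).
Qed.

Fact tmul1l : left_id tone tmul.
Proof.
move=> a; apply/tensorP => s sm; rewrite tcoef_mul // -[RHS]wconv1l.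
by apply: eq_wconv => // s' _; rewrite tcoef_one.
Qed.

Fact tmul1r : right_id tone tmul.
Proof.
move=> a; apply/tensorP => s sm; rewrite tcoef_mul // -[RHS]wconv1r.
by apply: eq_wconv => // s' _; rewrite tcoef_one.
Qed.

Fact tmulDl : left_distributive tmul +%R.
Proof.
move=> a b c; apply/tensorP => s sm; rewrite tcoefD !tcoef_mul // -wconvDl.
by apply: eq_wconv => // s' _; rewrite tcoefD.
Qed.

Fact tmulDr : right_distributive tmul +%R.
Proof.
move=> a b c; apply/tensorP => s sm; rewrite tcoefD !tcoef_mul // -wconvDr.
by apply: eq_wconv => // s' _; rewrite tcoefD.
Qed.

Fact tone_neq0 : tone != 0.
Proof.
apply/eqP => /tensorP/(_ [::] isT); rewrite tcoef_one tcoef0 => /eqP.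
by rewrite oner_eq0.
Qed.

HB.instance Definition _ := GRing.Zmodule_isNzRing.Build (ttensor V m)
  tmulA tmul1l tmul1r tmulDl tmulDr tone_neq0.

Fact tscaleAl k a b : k *: (a * b) = k *: a * b.
Proof.
apply/tensorP => s sm; rewrite tcoefZ !tcoef_mul // -wconvZl.
by apply: eq_wconv => // s' _; rewrite tcoefZ.
Qed.

Fact tscaleAr k a b : k *: (a * b) = a * (k *: b).
Proof.
apply/tensorP => s sm; rewrite tcoefZ !tcoef_mul // -wconvZr.
by apply: eq_wconv => // s' _; rewrite tcoefZ.
Qed.

HB.instance Definition _ :=
  GRing.Lmodule_isLalgebra.Build K (ttensor V m) tscaleAl.
HB.instance Definition _ :=
  GRing.Lalgebra_isAlgebra.Build K (ttensor V m) tscaleAr.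

Lemma tcoef_nilM a b : tcoef (a * b) [::] = tcoef a [::] * tcoef b [::].
Proof. by rewrite tcoef_mul // wconv_nil. Qed.

Lemma tcoefX_small a n s :
  tcoef a [::] = 0 -> (size s < n)%N -> tcoef (a ^+ n) s = 0.
Proof.
move=> a0; elim: n s => // n IH s sn.
have [sm|] := leqP (size s) m; last exact: tcoef_out.
rewrite exprS tcoef_mul //; apply: big1 => -[[|i] /= lti] _.
  by rewrite take0 a0 mul0r.
case: s sn sm lti => // x s sn _ _; rewrite IH ?mulr0 //.
by rewrite size_drop subSS (leq_ltn_trans (leq_subr _ _)).
Qed.

Lemma tnilp a : tcoef a [::] = 0 -> a ^+ m.+1 = 0.
Proof.
by move=> a0; apply/tensorP => s sm; rewrite tcoefX_small ?tcoef0.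
Qed.

Definition tunit : pred T := fun a => tcoef a [::] != 0.

(* For a = c 1 + n with c != 0 and n without scalar part, a^-1 is given by the
   (finite) Neumann series. *)
Definition tinv a : T :=
  if tunit a
  then (tcoef a [::])^-1 *: \sum_(k < m.+1) (1 - (tcoef a [::])^-1 *: a) ^+ k
  else a.

Lemma tinv_neumann a : tunit a ->
  let c := (tcoef a [::])^-1 in
  c *: a * \sum_(k < m.+1) (1 - c *: a) ^+ k = 1.
Proof.
move=> ua c; have /tnilp u0 : tcoef (1 - c *: a) [::] = 0.
  by rewrite tcoefD tcoefN tcoefZ tcoef_one mulVf // subrr.
have := subrX1 (1 - c *: a) m.+1; rewrite u0 sub0r addrAC subrr sub0r mulNr.
by move/oppr_inj.
Qed.

Fact tmulVr : {in tunit, left_inverse 1 tinv *%R}.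
Proof.
move=> a ua; rewrite /tinv ifT // -scalerAl scalerAr.
set c := (tcoef a [::])^-1.
have cm : GRing.comm (\sum_(k < m.+1) (1 - c *: a) ^+ k) (c *: a).
  apply: commr_sym; apply: commr_sum => k _; apply: commrX.
  by apply: commrB; [exact: commr1|exact: commr_refl].
by rewrite cm tinv_neumann.
Qed.

Fact tdivrr : {in tunit, right_inverse 1 tinv *%R}.
Proof.
by move=> a ua; rewrite /tinv ifT // -scalerAr scalerAl tinv_neumann.
Qed.

Fact tunitP a b : b * a = 1 /\ a * b = 1 -> tunit a.
Proof.
case=> _ ab; have := tcoef_nilM a b; rewrite ab tcoef_one /tunit => /esym h.
by apply/eqP => a0; move/eqP: h; rewrite a0 mul0r eq_sym oner_eq0.
Qed.

Fact tinv_out : {in [predC tunit], tinv =1 id}.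
Proof. by move=> a ua; rewrite /tinv ifN. Qed.

HB.instance Definition _ := GRing.NzRing_hasMulInverse.Build (ttensor V m)
  tmulVr tdivrr tunitP tinv_out.

(* The inclusion of V = V^{(x)1}. *)
Definition tvec (v : V) : T :=
  mktensor (fun s => if s is [:: i] then coord (vbasis {:V}) i v else 0).

Definition tbracket a b : T := a * b - b * a.

Definition is_lie_subalgebra (A : set T) : Prop :=
  [/\ A 0,
      forall a b, A a -> A b -> A (a + b),
      forall k a, A a -> A (k *: a) &
      forall a b, A a -> A b -> A (tbracket a b)].

Definition free_lie : set T := smallest is_lie_subalgebra (range tvec).

(* On elements without scalar part, in particular on free_lie, the exponential
   series stops at degree m. *)
Definition texp a : T := \sum_(k < m.+1) (k`!%:R)^-1 *: a ^+ k.

Definition free_group : set T := texp @` free_lie.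

Definition dilation (t : K) a : T := mktensor (fun s => t ^+ size s * tcoef a s).

End TruncatedTensorAlgebra.

Section RoughPaths.
Variables (R : realType) (V : normedVectType R) (m : nat).
Notation T := (ttensor V m).
Notation G := (@free_group R V m).

(* A norm on G is given as a function on the whole algebra of which only the
   values on G are constrained. *)
Definition homogeneous_norm (N : T -> R) : Prop :=
  [/\ forall g, G g -> 0 <= N g,
      forall g, G g -> (N g = 0 <-> g = 1),
      forall (t : R) g, G g -> N (dilation t g) = `|t| * N g,
      forall g h, G g -> G h -> N (g * h) <= N g + N h &
      forall g, G g -> N g^-1 = N g].

Definition d_group (N : T -> R) (g h : T) : R := N (g^-1 * h).

(* Only the values on [0, 1] of a path are relevant; the topology on the
   finite-dimensional space T is that of coordinatewise convergence. *)
Definition G_path (Y : R -> T) : Prop :=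
  [/\ forall t : R, t \in `[0, 1] -> G (Y t),
      Y 0 = 1 &
      forall w, {within `[0, 1], continuous (fun t : R => tcoef (Y t) w)}].

Definition increment (Y : R -> T) (s t : R) : T := (Y s)^-1 * Y t.

Definition simplex : set (R * R) := [set st | 0 <= st.1 <= st.2 /\ st.2 <= 1].

Definition control (omega : R -> R -> R) : Prop :=
  [/\ {within simplex, continuous (fun st => omega st.1 st.2)},
      forall s t : R, 0 <= s -> s <= t -> t <= 1 -> 0 <= omega s t,
      forall t : R, 0 <= t -> t <= 1 -> omega t t = 0 &
      forall s t u : R, 0 <= s -> s < t -> t < u -> u <= 1 ->
        omega s t + omega t u <= omega s u].

Definition d_omega (N : T -> R) (omega : R -> R -> R) (p : R)
    (x y : R -> T) : \bar R :=
  ereal_sup [set r | exists s t : R, [/\ 0 <= s, s < t, t <= 1 &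
    r = (d_group N (increment x s t) (increment y s t)
          / omega s t `^ p^-1)%:E]].

Definition C_omega (N : T -> R) (omega : R -> R -> R) (p : R) :
    set (R -> T) :=
  [set Y | G_path Y /\ (d_omega N omega p Y (fun=> 1%R) < +oo)%E].

End RoughPaths.

Definition metric_on (R : realType) (X : Type) (C : set X)
    (eqX : X -> X -> Prop) (d : X -> X -> \bar R) : Prop :=
  [/\ forall x y, C x -> C y -> (0 <= d x y < +oo)%E,
      forall x y, C x -> C y -> (d x y = 0%E <-> eqX x y),
      forall x y, C x -> C y -> d x y = d y x &
      forall x y z, C x -> C y -> C z -> (d x z <= d x y + d y z)%E].

Definition complete_on (R : realType) (X : Type) (C : set X)
    (d : X -> X -> \bar R) : Prop :=
  forall u : nat -> X,
    (forall n, C (u n)) ->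
    (forall e : R, 0 < e ->
      exists M, forall i j, (M <= i)%N -> (M <= j)%N ->
        (d (u i) (u j) < e%:E)%E) ->
    exists2 y, C y & d (u n) y @[n --> \oo] --> 0%E.

(* Main.v *)
Require Import Defs.
From HB Require Import structures.
From mathcomp Require Import all_boot all_order all_algebra.
From mathcomp Require Import all_classical all_reals all_analysis.
From mathcomp Require Import zify.
Import Order.TTheory GRing.Theory Num.Theory.
Import numFieldNormedType.Exports.
Local Open Scope classical_set_scope.
Local Open Scope ring_scope.

(**
  No continuity of the homogeneous norm N is assumed, so its comparison with
  the coordinate topology has to be proved. Let D be the Dynkin map (a word is
  sent to its right-normed bracket) and delta the degree derivation. On the
  free Lie algebra D = delta, and g lies in the free nilpotent group if and
  only if its scalar part is 1, the algebra extension theta of ad sends g to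
  the conjugation by g, and delta g = D(g) g. Hence the group is closed under
  products, inverses and limits, and the lowest component of an element is a
  Lie element.

  If g -> 1 in the group, then N g -> 0: peel off the components of g one
  degree n at a time by factors exp (c rbracket w), whose norms are
  O(|c|^(1/n)) by homogeneity. Conversely, if N g -> 0 then g -> 1: otherwise,
  after dilating, group elements at a fixed distance from 1 would accumulate at
  an element of norm 0. So (G, N) is complete with the coordinate topology, and
  Cauchy sequences of paths converge pointwise, uniformly in the sense of
  d_omega; the limit is continuous because omega vanishes on the diagonal.
*)

Set Implicit Arguments.
Unset Strict Implicit.
Unset Printing Implicit Defensive.

(** * Word basis of the truncated tensor algebra, order filtration and commutator *)

Section WordBasis.
Variables (K : fieldType) (V : vectType K) (m : nat).
Notation T := (ttensor V m).
Notation word := (seq 'I_(\dim {:V})).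
Implicit Types (a b c x y : T) (s u v w : word).

Definition tword w : T := mktensor m (fun s => (s == w)%:R).

Lemma tcoef_word w s : (size s <= m)%N -> tcoef (tword w) s = (s == w)%:R.
Proof. by move=> sm; rewrite tcoef_mk sm. Qed.

Lemma tword_out w : (m < size w)%N -> tword w = 0.
Proof.
move=> mw; apply/tensorP => s sm; rewrite tcoef_word // tcoef0.
by case: eqP => // sw; rewrite sw leqNgt mw in sm.
Qed.

Lemma tword_nil : tword [::] = 1.
Proof.
by apply/tensorP => s sm; rewrite tcoef_word // tcoef_one; case: s {sm}.
Qed.

Lemma wconv_word u v s :
  wconv (fun s' => (s' == u)%:R) (fun s' => (s' == v)%:R) s =
  (s == u ++ v)%:R :> K.
Proof.
elim: u s => [|i u IH] [|j s] /=.
- by rewrite wconv_nil mul1r.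
- rewrite wconv_cons mul1r (eq_wconv (f' := fun=> 0) (g' := fun s' => (s' == v)%:R)) //.
  by rewrite wconv0l addr0.
- by rewrite wconv_nil mul0r.
- rewrite wconv_cons mul0r add0r eqseq_cons.
  case: (j =P i) => [->|ji] /=.
    rewrite -IH; apply: eq_wconv => // s' _.
    by rewrite eqseq_cons eqxx.
  rewrite -[RHS](wconv0l (fun s' => (s' == v)%:R) s).
  by apply: eq_wconv => // s' _; rewrite eqseq_cons (introF eqP ji).
Qed.

Lemma twordM u v : tword u * tword v = tword (u ++ v).
Proof.
apply/tensorP => s sm; rewrite tcoef_mul // tcoef_word // -wconv_word.
by apply: eq_wconv => s' s's; rewrite tcoef_word // (leq_trans s's).
Qed.

Lemma tensor_sumE a :
  a = \sum_(w : m.-bseq 'I_(\dim {:V})) tcoef a w *: tword w.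
Proof.
apply/tensorP => s sm.
have big c (F : m.-bseq 'I_(\dim {:V}) -> T) (r : seq _) :
    tcoef (\sum_(w <- r) F w) s = \sum_(w <- r) tcoef (F w) s.
  by apply: (big_morph (fun x => tcoef x s)) => [x y|]; rewrite ?tcoefD ?tcoef0.
rewrite big // (bigD1 (Bseq sm)) //= big1 ?addr0 => [|w ws].
  by rewrite tcoefZ tcoef_word // eqxx mulr1.
rewrite tcoefZ tcoef_word //; case: eqP => [sw|]; last by rewrite mulr0.
by case/eqP: ws; apply: val_inj.
Qed.

Lemma tensor_ind (P : T -> Prop) : P 0 ->
    (forall k a b, P a -> P b -> P (k *: a + b)) ->
    (forall w, (size w <= m)%N -> P (tword w)) ->
  forall a, P a.
Proof.
move=> P0 PD Pw a; rewrite (tensor_sumE a).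
elim: (index_enum _) => [|w r IH]; first by rewrite big_nil.
by rewrite big_cons; apply: PD IH; apply: Pw; exact: size_bseq.
Qed.

Lemma tcoef_sum (J : Type) (r : seq J) (P : pred J) (F : J -> T) s :
  tcoef (\sum_(j <- r | P j) F j) s = \sum_(j <- r | P j) tcoef (F j) s.
Proof.
by apply: (big_morph (fun x => tcoef x s)) => [x y|]; rewrite ?tcoefD ?tcoef0.
Qed.

(** The n-th power of the ideal of elements without scalar part. Statements about lowest components
    become congruences modulo the next order, and truncation enters through [tord_eq0]. *)
Definition tord n a := forall s, (size s < n)%N -> tcoef a s = 0.

Lemma tordW n k a : (k <= n)%N -> tord n a -> tord k a.
Proof. by move=> kn an s sk; apply: an; apply: leq_trans kn. Qed.

Lemma tord0 n : tord n 0. Proof. by move=> s _; rewrite tcoef0. Qed.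

Lemma tord_leq0 a : tord 0 a. Proof. by []. Qed.

Lemma tord1 a : tord 1 a <-> tcoef a [::] = 0.
Proof. by split=> [|a0 [|//] _]; [exact|]. Qed.

Lemma tord_eq0 n a : (m < n)%N -> tord n a -> a = 0.
Proof.
move=> mn an; apply/tensorP => s sm; rewrite tcoef0 an //.
exact: leq_ltn_trans mn.
Qed.

Lemma tordD n a b : tord n a -> tord n b -> tord n (a + b).
Proof. by move=> an bn s sn; rewrite tcoefD an // bn // addr0. Qed.

Lemma tordZ n k a : tord n a -> tord n (k *: a).
Proof. by move=> an s sn; rewrite tcoefZ an // mulr0. Qed.

Lemma tordN n a : tord n a -> tord n (- a).
Proof. by move=> an; rewrite -scaleN1r; apply: tordZ. Qed.

Lemma tordB n a b : tord n a -> tord n b -> tord n (a - b).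
Proof. by move=> an bn; apply: tordD => //; apply: tordN. Qed.

Lemma tord_sum n (J : Type) (r : seq J) (P : pred J) (F : J -> T) :
  (forall j, P j -> tord n (F j)) -> tord n (\sum_(j <- r | P j) F j).
Proof.
by move=> Fn; apply: big_ind => //; [exact: tord0|exact: tordD].
Qed.

(** When a word shorter than n + k is split, the prefix is shorter than n or the suffix is shorter
    than k. *)
Lemma tordM n k a b : tord n a -> tord k b -> tord (n + k) (a * b).
Proof.
move=> an bk s snk; have [sm|/tcoef_out ->//] := leqP (size s) m.
rewrite tcoef_mul //; apply: big1 => -[i /= ltis] _.
have [lin|leni] := ltnP i n.
  by rewrite an ?mul0r // size_take; case: ifP; lia.
by rewrite bk ?mulr0 // size_drop; lia.
Qed.

Lemma tordX n a : tord 1 a -> tord n (a ^+ n).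
Proof.
move=> a1; elim: n => [|n IH]; first exact: tord_leq0.
by rewrite exprS -add1n; apply: tordM.
Qed.

Lemma tord_bracket n k a b : tord n a -> tord k b -> tord (n + k) (tbracket a b).
Proof.
by move=> an bk; apply: tordB; [|rewrite addnC]; exact: tordM.
Qed.

Lemma tord_word w : tord (size w) (tword w).
Proof.
move=> s sw; have [sm|/tcoef_out ->//] := leqP (size s) m.
by rewrite tcoef_word //; case: eqP => // swe; rewrite swe ltnn in sw.
Qed.

Lemma tbracketDl k a b c :
  tbracket (k *: a + b) c = k *: tbracket a c + tbracket b c.
Proof.
rewrite /tbracket mulrDl mulrDr scalerBr -!scalerAl -!scalerAr.
by rewrite opprD addrACA.
Qed.

Lemma tbracketDr k a b c :
  tbracket c (k *: a + b) = k *: tbracket c a + tbracket c b.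
Proof.
rewrite /tbracket mulrDl mulrDr scalerBr -!scalerAl -!scalerAr.
by rewrite opprD addrACA.
Qed.

Lemma tbracket0 a : tbracket a 0 = 0.
Proof. by rewrite /tbracket mulr0 mul0r subr0. Qed.

Lemma tbracketC a b : tbracket a b = - tbracket b a.
Proof. by rewrite /tbracket opprB. Qed.

Lemma tbracket_jacobi a b c :
  tbracket (tbracket a b) c =
  tbracket a (tbracket b c) - tbracket b (tbracket a c).
Proof.
rewrite /tbracket !mulrBl !mulrBr !mulrA !opprB.
rewrite [RHS](AC ((2*2)*(2*2)) ((1*8)*(3*6)*(2*5)*(4*7))) /= !addNr !addr0.
by [].
Qed.

End WordBasis.

(** * Free Lie algebra, adjoint action, Dynkin map and degree derivation *)

Section Dynkin.
Variables (K : numFieldType) (V : vectType K) (m : nat).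
Notation T := (ttensor V m).
Notation word := (seq 'I_(\dim {:V})).
Notation L := (@free_lie K V m).
Notation letter i := (tword m [:: i]).
Implicit Types (a b c x y : T) (s u v w : word).

Lemma free_lie_subalgebra : is_lie_subalgebra L.
Proof.
split=> [A [[A0 _ _ _] _]//|a b La Lb A AP|k a La A AP|a b La Lb A AP].
- by case: (AP) => [[_ AD _ _] _]; apply: AD; [exact: La|exact: Lb].
- by case: (AP) => [[_ _ AZ _] _]; apply: AZ; exact: La.
- by case: (AP) => [[_ _ _ AB] _]; apply: AB; [exact: La|exact: Lb].
Qed.

Lemma free_lie0 : L 0. Proof. by case: free_lie_subalgebra. Qed.
Lemma free_lieD a b : L a -> L b -> L (a + b).
Proof. by case: free_lie_subalgebra => _ + _ _; exact. Qed.
Lemma free_lieZ k a : L a -> L (k *: a).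
Proof. by case: free_lie_subalgebra => _ _ + _; exact. Qed.
Lemma free_lie_bracket a b : L a -> L b -> L (tbracket a b).
Proof. by case: free_lie_subalgebra => _ _ _ +; exact. Qed.

Lemma free_lie_sum (J : Type) (r : seq J) (P : pred J) (F : J -> T) :
  (forall j, P j -> L (F j)) -> L (\sum_(j <- r | P j) F j).
Proof.
by move=> LF; apply: big_ind => //; [exact: free_lie0|exact: free_lieD].
Qed.

Lemma free_lie_letter i : L (letter i).
Proof.
move=> A [_ AV]; apply: AV; exists (vbasis {:V})`_i => //.
apply/tensorP => s sm; rewrite tcoef_mk tcoef_word // sm.
case: s sm => [|j [|j' s]] //= _; last by rewrite eqseq_cons andbF.
by rewrite coord_free ?(basis_free (vbasisP _)) // eqseq_cons andbT eq_sym.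
Qed.

Lemma tvecE (v : V) : tvec m v = \sum_i coord (vbasis {:V}) i v *: (letter i).
Proof.
apply/tensorP => s sm; rewrite tcoef_mk sm tcoef_sum.
have [[j sE]|sj] : {j | s = [:: j]} + {forall j, s != [:: j]}.
- case: s sm => [|j [|k s]] _; [by right|by left; exists j|].
  by right=> j'; rewrite eqseq_cons andbF.
- subst s; rewrite (bigD1 j) //= big1 ?addr0 => [|k kj].
    by rewrite tcoefZ tcoef_word // eqxx mulr1.
  by rewrite tcoefZ tcoef_word // eqseq_cons andbT eq_sym (negbTE kj) mulr0.
- rewrite big1 => [|j _]; last by rewrite tcoefZ tcoef_word // (negbTE (sj j)) mulr0.
  by case: s sj {sm} => [|j [|]] // /(_ j); rewrite eqxx.
Qed.

(** Every [tvec v] is a linear combination of letters, so linearity carries [P] from the letters to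
    all generators. *)
Lemma free_lie_ind (P : T -> Prop) :
    P 0 -> (forall k a b, P a -> P b -> P (k *: a + b)) ->
    (forall i, P (letter i)) ->
    (forall a b, P a -> P b -> P (tbracket a b)) ->
  forall a, L a -> P a.
Proof.
move=> P0 PD Pe PB a; apply; split; first split=> //.
- by move=> b c Pb Pc; rewrite -[b]scale1r; exact: PD.
- by move=> k b Pb; rewrite -[_ *: _]addr0; exact: PD.
- move=> _ [v _ <-]; rewrite tvecE.
  elim: (index_enum _) => [|i r IH]; first by rewrite big_nil.
  by rewrite big_cons; exact: PD.
Qed.

Definition wlin (F : word -> T) a : T :=
  \sum_(w : m.-bseq 'I_(\dim {:V})) tcoef a w *: F w.

Lemma wlinD F k a b : wlin F (k *: a + b) = k *: wlin F a + wlin F b.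
Proof.
rewrite /wlin scaler_sumr -big_split; apply: eq_bigr => w _ /=.
by rewrite tcoefD tcoefZ scalerDl scalerA.
Qed.

Lemma wlin0 F : wlin F 0 = 0.
Proof. by apply: big1 => w _; rewrite tcoef0 scale0r. Qed.

Lemma wlin_ord F n k a : (forall w, tord (size w + k) (F w)) ->
  tord n a -> tord (n + k) (wlin F a).
Proof.
move=> oF oa; apply: tord_sum => w _; have [wn|nw] := ltnP (size w) n.
  by rewrite oa // scale0r; exact: tord0.
by apply: tordZ; apply: tordW (oF w); rewrite leq_add2r.
Qed.

(** The hypothesis makes [F w] vanish for words longer than m, just as [tword m w] does; later
    computations on words can therefore ignore the truncation. *)
Lemma wlin_word F w : (forall w, tord (size w) (F w)) -> wlin F (tword m w) = F w.
Proof.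
move=> oF; have [wm|mw] := leqP (size w) m; last first.
  by rewrite tword_out // wlin0; exact/esym/(tord_eq0 mw)/oF.
rewrite /wlin (bigD1 (Bseq wm)) //= big1 ?addr0 => [|v vw].
  by rewrite tcoef_word // eqxx scale1r.
rewrite tcoef_word ?size_bseq //; case: eqP => [vwE|]; last by rewrite scale0r.
by case/eqP: vw; apply: val_inj.
Qed.

(** Composite of the operators ad of the letters of [w], the first letter acting last. *)
Definition adw w y : T := foldr (fun i z => tbracket (letter i) z) y w.

Definition theta a y : T := wlin (adw^~ y) a.

(** The recursion stops at one letter: bracketing it with the value 0 of the empty word would
    annihilate everything. *)
Fixpoint rbracket w : T :=
  if w is i :: s then (if nilp s then (letter i) else tbracket (letter i) (rbracket s))
  else 0.

Definition dynkin a : T := wlin rbracket a.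

Definition tdeg a : T := mktensor m (fun s => (size s)%:R * tcoef a s).

Lemma tord_adw k w y : tord k y -> tord (size w + k) (adw w y).
Proof.
move=> yk; elim: w => //= i w IH; rewrite addSn -add1n.
by apply: tord_bracket => //; exact: (@tord_word _ _ _ [:: i]).
Qed.

Lemma tord_rbracket w : tord (size w) (rbracket w).
Proof.
elim: w => [|i w IH] //; case: w IH => [|j w] IH.
  exact: (@tord_word _ _ _ [:: i]).
rewrite -[size _]add1n; apply: tord_bracket => //.
exact: (@tord_word _ _ _ [:: i]).
Qed.

Lemma free_lie_rbracket w : L (rbracket w).
Proof.
elim: w => [|i w IH] /=; first exact: free_lie0.
case: ifP => _; first exact: free_lie_letter.
by apply: free_lie_bracket => //; exact: free_lie_letter.
Qed.

Lemma adwD w k x y : adw w (k *: x + y) = k *: adw w x + adw w y.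
Proof. by elim: w => //= i w ->; rewrite tbracketDr. Qed.

Lemma adw0 w : adw w 0 = 0.
Proof. by elim: w => //= i w ->; rewrite tbracket0. Qed.

Lemma thetaDl k a b y : theta (k *: a + b) y = k *: theta a y + theta b y.
Proof. exact: wlinD. Qed.

Lemma thetaDr a k x y : theta a (k *: x + y) = k *: theta a x + theta a y.
Proof.
rewrite /theta /wlin scaler_sumr -big_split; apply: eq_bigr => w _ /=.
by rewrite adwD scalerDr !scalerA mulrC.
Qed.

Lemma theta0l y : theta 0 y = 0. Proof. exact: wlin0. Qed.

Lemma theta0r a : theta a 0 = 0.
Proof. by apply: big1 => w _; rewrite adw0 scaler0. Qed.

Lemma theta_word w y : theta (tword m w) y = adw w y.
Proof.
by apply: wlin_word => u; rewrite -[size u]addn0; apply: tord_adw.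
Qed.

Lemma theta1 y : theta 1 y = y.
Proof. by rewrite -tword_nil theta_word. Qed.

(** On words, concatenation corresponds to composition of the ad operators. *)
Lemma thetaM a b y : theta (a * b) y = theta a (theta b y).
Proof.
elim/tensor_ind: a => [|k a a' IHa IHa'|u _].
- by rewrite mul0r !theta0l.
- by rewrite mulrDl -scalerAl !thetaDl IHa IHa'.
elim/tensor_ind: b => [|k b b' IHb IHb'|v _].
- by rewrite mulr0 !theta0l theta0r.
- by rewrite mulrDr -scalerAr !thetaDl thetaDr IHb IHb'.
by rewrite twordM !theta_word /adw foldr_cat.
Qed.

Lemma dynkinD k a b : dynkin (k *: a + b) = k *: dynkin a + dynkin b.
Proof. exact: wlinD. Qed.

Lemma dynkin0 : dynkin 0 = 0. Proof. exact: wlin0. Qed.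

Lemma dynkinN a : dynkin (- a) = - dynkin a.
Proof.
by have := dynkinD (-1) a 0; rewrite dynkin0 !addr0 !scaleN1r.
Qed.

Lemma dynkinB a b : dynkin (a - b) = dynkin a - dynkin b.
Proof. by rewrite -[a]scale1r dynkinD dynkinN !scale1r. Qed.

Lemma dynkin_word w : dynkin (tword m w) = rbracket w.
Proof. by apply: wlin_word; exact: tord_rbracket. Qed.

Lemma dynkin1 : dynkin 1 = 0.
Proof. by rewrite -tword_nil dynkin_word. Qed.

Lemma tord_dynkin n a : tord n a -> tord n (dynkin a).
Proof.
move=> an; rewrite -[n]addn0; apply: wlin_ord => // w; rewrite addn0.
exact: tord_rbracket.
Qed.

Lemma free_lie_dynkin a : L (dynkin a).
Proof.
by apply: free_lie_sum => w _; apply: free_lieZ; exact: free_lie_rbracket.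
Qed.

(** On words, putting [u] before a nonempty [v] applies [adw u] to the bracket of [v]. An empty [v]
    has bracket 0 and leaves [dynkin a], whence the scalar term. *)
Lemma dynkinM a b :
  dynkin (a * b) = tcoef b [::] *: dynkin a + theta a (dynkin b).
Proof.
elim/tensor_ind: a => [|k a a' IHa IHa'|u _].
- by rewrite mul0r theta0l dynkin0 scaler0 addr0.
- rewrite mulrDl -scalerAl !dynkinD thetaDl IHa IHa' !scalerDr !scalerA mulrC.
  by rewrite addrACA.
elim/tensor_ind: b => [|k b b' IHb IHb'|v _].
- by rewrite mulr0 dynkin0 theta0r tcoef0 scale0r addr0.
- rewrite mulrDr -scalerAr !dynkinD thetaDr IHb IHb' tcoefD tcoefZ.
  by rewrite scalerDr !scalerDl !scalerA addrACA.
rewrite twordM !dynkin_word theta_word tcoef_word //.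
case: v => [|i v]; first by rewrite cats0 scale1r adw0 addr0.
rewrite scale0r add0r; elim: u => //= j u ->.
by case: u.
Qed.

Lemma tcoef_deg a s : tcoef (tdeg a) s = (size s)%:R * tcoef a s.
Proof.
by rewrite tcoef_mk; case: leqP => // ms; rewrite tcoef_out // mulr0.
Qed.

Lemma tdegD k a b : tdeg (k *: a + b) = k *: tdeg a + tdeg b.
Proof.
apply/tensorP => s sm.
by rewrite tcoefD tcoefZ !tcoef_deg tcoefD tcoefZ mulrDr mulrCA.
Qed.

Lemma tdeg0 : tdeg 0 = 0.
Proof. by apply/tensorP => s sm; rewrite tcoef_deg !tcoef0 mulr0. Qed.

Lemma tdegN a : tdeg (- a) = - tdeg a.
Proof. by have := tdegD (-1) a 0; rewrite tdeg0 !addr0 !scaleN1r. Qed.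

Lemma tdegB a b : tdeg (a - b) = tdeg a - tdeg b.
Proof. by rewrite -[a]scale1r tdegD tdegN !scale1r. Qed.

Lemma tdegM a b : tdeg (a * b) = tdeg a * b + a * tdeg b.
Proof.
apply/tensorP => s sm; rewrite tcoefD tcoef_deg !tcoef_mul //.
rewrite /wconv mulr_sumr -big_split; apply: eq_bigr => i _ /=.
rewrite !tcoef_deg -{1}(cat_take_drop i s) size_cat natrD mulrDl.
by rewrite mulrA mulrCA.
Qed.

Lemma tdeg1 : tdeg 1 = 0.
Proof.
by apply/tensorP => -[|i s] sm; rewrite tcoef_deg tcoef_one tcoef0 ?mul0r ?mulr0.
Qed.

Lemma tord_deg n a : tord n a -> tord n (tdeg a).
Proof. by move=> an s sn; rewrite tcoef_deg an // mulr0. Qed.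

Lemma tord_lie a : L a -> tord 1 a.
Proof.
move: a; apply: free_lie_ind => [|k a b a1 b1|i|a b a1 b1].
- exact: tord0.
- by apply: tordD => //; exact: tordZ.
- exact: (@tord_word _ _ _ [:: i]).
- by apply: (@tordW _ _ _ 2) => //; exact: (tord_bracket a1 b1).
Qed.

(** Both sides turn brackets into commutators of operators, the left one by multiplicativity and the
    right one by the Jacobi identity, and they agree on letters. *)
Lemma theta_lie a y : L a -> theta a y = tbracket a y.
Proof.
move=> La; move: a La y; apply: free_lie_ind.
- by move=> y; rewrite theta0l tbracketC tbracket0 oppr0.
- by move=> k a b IHa IHb y; rewrite thetaDl tbracketDl IHa IHb.
- by move=> i y; rewrite theta_word.
- move=> a b IHa IHb y; rewrite tbracket_jacobi /tbracket.
  by rewrite addrC -scaleN1r thetaDl !thetaM !IHa !IHb scaleN1r addrC.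
Qed.

(** The Dynkin-Specht-Wever theorem. Lie elements have no scalar part, so [dynkinM] gives D[a,b] =
    [a,Db] - [b,Da], which is the Leibniz rule once D is the degree derivation on a and b. *)
Lemma dynkin_lie a : L a -> dynkin a = tdeg a.
Proof.
move=> La.
(* Membership is carried through the induction because [tord_lie] and [theta_lie] need it for both
   arguments of a bracket. *)
suff [] : L a /\ dynkin a = tdeg a by [].
move: a La; apply: free_lie_ind => [|k a b [La Da] [Lb Db]|i|a b [La Da] [Lb Db]].
- by split; [exact: free_lie0|rewrite dynkin0 tdeg0].
- split; first by apply: free_lieD => //; exact: free_lieZ.
  by rewrite dynkinD tdegD Da Db.
- split; first exact: free_lie_letter.
  rewrite dynkin_word /=; apply/tensorP => s sm; rewrite tcoef_deg tcoef_word //.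
  by case: eqP => [->|]; rewrite ?mulr0 ?mul1r.
- split; first exact: free_lie_bracket.
  have [a0 b0] := (tord_lie La, tord_lie Lb).
  rewrite dynkinB !dynkinM (a0 [::]) // (b0 [::]) // !scale0r !add0r.
  rewrite !theta_lie // Da Db tdegB !tdegM /tbracket.
  rewrite !opprB !opprD.
  by rewrite [LHS](AC (2*2) ((3*1)*(2*4))).
Qed.

End Dynkin.

(** * The free nilpotent group described by polynomial equations *)

Section FreeGroup.
Variables (K : numFieldType) (V : vectType K) (m : nat).
Notation T := (ttensor V m).
Notation L := (@free_lie K V m).
Implicit Types (a b c g h x y : T).

(* These are polynomial, hence closed, conditions; free_groupP shows that they
   define the group. *)
Definition dynkin_group : set T := [set g |
  [/\ tcoef g [::] = 1, forall y, theta g y * g = g * y &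
      tdeg g = dynkin g * g]].

Lemma tunit1 g : tcoef g [::] = 1 -> g \is a GRing.unit.
Proof. by move=> g1; rewrite unfold_in /= /tunit g1 oner_neq0. Qed.

Lemma dynkin_group1 : dynkin_group 1.
Proof.
split; first by rewrite tcoef_one.
- by move=> y; rewrite theta1 mulr1 mul1r.
- by rewrite tdeg1 dynkin1 mul0r.
Qed.

Lemma dynkin_groupM g h : dynkin_group g -> dynkin_group h -> dynkin_group (g * h).
Proof.
case=> g1 tg dg [h1 th dh]; split.
- by rewrite tcoef_nilM g1 h1 mulr1.
- by move=> y; rewrite thetaM mulrA tg -mulrA th mulrA.
- by rewrite tdegM dynkinM h1 scale1r mulrDl !mulrA tg dg dh -!mulrA.
Qed.

(** The conjugation rule comes from theta(g) theta(g^-1) = id, the derivative rule from applying D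
    to g^-1 g = 1 and the degree derivation to g g^-1 = 1. *)
Lemma dynkin_groupV g : dynkin_group g -> dynkin_group g^-1.
Proof.
case=> g1 tg dg; have ug := tunit1 g1.
have tgV y : theta g^-1 y * g^-1 = g^-1 * y.
  apply: (mulrI ug); apply: (mulIr ug).
  by rewrite /= !mulrA divrK // divrr // mul1r -tg -thetaM divrr // theta1.
split=> //.
- have := tcoef_nilM g g^-1.
  by rewrite divrr // tcoef_one g1 mul1r => <-.
- have d1 : dynkin g^-1 = - theta g^-1 (dynkin g).
    apply/eqP; rewrite -addr_eq0 -[dynkin g^-1]scale1r -[X in X *: _]g1.
    by rewrite -dynkinM mulVr // dynkin1.
  rewrite d1 mulNr tgV; apply: (mulrI ug).
  rewrite mulrN mulVKr //; apply/eqP; rewrite -addr_eq0; apply/eqP.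
  have := tdegM g g^-1; rewrite divrr // tdeg1 dg mulrK // addrC => /esym.
  by [].
Qed.

(** * Exponentials of Lie elements, and the logarithm degree by degree *)

Lemma tnilpX a n : tord 1 a -> (m < n)%N -> a ^+ n = 0.
Proof. by move=> a1 mn; apply: (tord_eq0 mn); exact: tordX. Qed.

Lemma sum_triangle (U : nmodType) M (F : nat -> nat -> U) :
    (forall k j, (M <= k + j)%N -> F k j = 0) ->
  \sum_(n < M) \sum_(k < n.+1) F k (n - k)%N = \sum_(k < M) \sum_(j < M) F k j.
Proof.
move=> F0.
transitivity (\sum_(n < M) \sum_(k < M | (k <= n)%N) F k (n - k)%N).
  apply: eq_bigr => n _.
  by rewrite (big_ord_widen_cond M predT (fun k => F k (n - k)%N)).
rewrite (exchange_big_dep predT) //=; apply: eq_bigr => k _.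
rewrite -(big_mkord (fun n => k <= n)%N (fun n => F k (n - k)%N)).
rewrite -(big_mkord predT (F k)).
rewrite (big_cat_nat (n := k)) //= ?(ltnW (ltn_ord k)) //.
rewrite big1_seq ?add0r; last first.
  by move=> i; rewrite mem_index_iota; lia.
rewrite [RHS](big_cat_nat (n := (M - k)%N)) //= ?leq_subr //.
rewrite [X in _ = _ + X]big1_seq ?addr0; last first.
  by move=> i; rewrite mem_index_iota => /andP[_ ?]; apply: F0; lia.
transitivity (\sum_(0 + k <= n < M | (k <= n)%N) F k (n - k)%N).
  by rewrite add0n.
rewrite big_addn big_nat_cond [RHS]big_nat_cond.
by apply: eq_big => [i|i _]; [rewrite leq_addl|rewrite addnK].
Qed.

(** Pascal's rule. When [f k.+1 = tbracket x (f k)], the factor [f k.+1 + f k * x] is [x * f k], so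
    the sum for n + 1 is x times the sum for n. *)
Lemma pascal_sum x (f : nat -> T) n :
  \sum_(k < n.+2) ('C(n.+1, k))%:R *: (f k * x ^+ (n.+1 - k)) =
  \sum_(k < n.+1) ('C(n, k))%:R *: ((f k.+1 + f k * x) * x ^+ (n - k)).
Proof.
rewrite big_ord_recl /= bin0 scale1r subn0.
under eq_bigr => k _.
  rewrite /bump /= add1n binS natrD scalerDl subSS addrC; over.
rewrite big_split /= addrCA.
under [RHS]eq_bigr => k _ do rewrite mulrDl scalerDr.
rewrite [RHS]big_split /=; congr (_ + _).
under [RHS]eq_bigr => k _.
  rewrite -mulrA -exprS -subSn -1?ltnS //; over.
rewrite [RHS]big_ord_recl /= bin0 scale1r subn0; congr (_ + _).
rewrite big_ord_recr /= bin_small // scale0r addr0.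
by apply: eq_bigr => k _; rewrite /bump /= add1n subSS.
Qed.

(** The factorials turn the binomial sums into a Cauchy product; the pairs of total degree above m
    vanish by order. *)
Lemma texp_cauchy x (f : nat -> T) : tord 1 x -> (forall k, tord k (f k)) ->
  \sum_(n < m.+1) (n`!%:R)^-1 *:
      \sum_(k < n.+1) ('C(n, k))%:R *: (f k * x ^+ (n - k)) =
  (\sum_(k < m.+1) (k`!%:R)^-1 *: f k) * texp x.
Proof.
move=> x1 of_; pose F k j := (k`!%:R)^-1 *: f k * ((j`!%:R)^-1 *: x ^+ j).
transitivity (\sum_(n < m.+1) \sum_(k < n.+1) F k (n - k)%N).
  apply: eq_bigr => n _; rewrite scaler_sumr; apply: eq_bigr => k _.
  rewrite /F -scalerAl -scalerAr !scalerA; congr (_ *: _).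
  have nz i : (i`!%:R : K) != 0 by rewrite pnatr_eq0 -lt0n fact_gt0.
  have kn : (k <= n)%N by rewrite -ltnS.
  rewrite -(bin_fact kn) !natrM.
  have bz : ('C(n, k)%:R : K) != 0 by rewrite pnatr_eq0 -lt0n bin_gt0.
  by rewrite !invfM mulrC mulVKf.
rewrite sum_triangle => [|k j mkj].
  rewrite mulr_suml; apply: eq_bigr => k _.
  by rewrite /texp mulr_sumr; apply: eq_bigr.
apply: (tord_eq0 mkj); apply: tordM; apply: tordZ; first exact: of_.
exact: tordX.
Qed.

Lemma wlin_sum F n (c : nat -> K) (f : nat -> T) :
  wlin F (\sum_(k < n) c k *: f k) = \sum_(k < n) c k *: wlin F (f k) :> T.
Proof.
elim: n => [|n IH]; first by rewrite !big_ord0 wlin0.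
by rewrite !big_ord_recr /= addrC wlinD IH addrC.
Qed.

Lemma texp_sum2 x : tord 1 x ->
  texp x = 1 + (x + \sum_(k < m) ((k.+2)`!%:R)^-1 *: x ^+ k.+2).
Proof.
(* A vanishing term of degree m + 1 is added, so that two terms can be split off even for m = 0. *)
move=> x1; transitivity (\sum_(k < m.+2) (k`!%:R)^-1 *: x ^+ k).
  by rewrite big_ord_recr /= tnilpX // scaler0 addr0.
by rewrite !big_ord_recl /= !invr1 !scale1r.
Qed.

Lemma texp_nil x : tord 1 x -> tcoef (texp x) [::] = 1.
Proof.
move=> x1; rewrite texp_sum2 // !tcoefD tcoef_one x1 // tcoef_sum big1 ?addr0 //.
by move=> k _; rewrite tcoefZ tcoefX_small ?mulr0 // x1.
Qed.

Lemma texp0 : texp (0 : T) = 1.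
Proof.
rewrite texp_sum2; last exact: tord0.
by rewrite add0r big1 ?addr0 // => k _; rewrite expr0n scaler0.
Qed.

Lemma theta_lieX x y k : L x -> theta (x ^+ k) y = iter k (tbracket x) y.
Proof.
move=> Lx; elim: k y => [|k IH] y; first by rewrite theta1.
by rewrite exprS thetaM IH theta_lie.
Qed.

Lemma tord_iter_bracket x y n k : tord 1 x -> tord n y ->
  tord (k + n) (iter k (tbracket x) y).
Proof.
move=> x1 yn; elim: k => //= k IH; rewrite addSn -add1n.
exact: tord_bracket.
Qed.

(** This is Ad(exp x) = exp(ad x). By induction, x^n y is the sum of the C(n,k) (ad x)^k(y) x^(n-k),
    and [texp_cauchy] sums these identities. *)
Lemma texp_conj x y : L x -> theta (texp x) y * texp x = texp x * y.
Proof.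
move=> Lx; have x1 := tord_lie Lx.
rewrite {1}/texp /theta (wlin_sum _ _ (fun k => (k`!%:R)^-1) (fun k => x ^+ k)).
under eq_bigr => k _ do rewrite -/(theta _ y) theta_lieX //.
rewrite -(texp_cauchy (f := fun k => iter k (tbracket x) y)) //; last first.
  by move=> k; rewrite -[k in tord k]addn0; apply: tord_iter_bracket.
rewrite /texp mulr_suml; apply: eq_bigr => n _.
rewrite -scalerAl; congr (_ *: _); elim: (n : nat) => [|{}n IH].
  by rewrite big_ord_recl big_ord0 addr0 bin0 scale1r mulr1 mul1r.
rewrite pascal_sum exprS -mulrA -IH mulr_sumr; apply: eq_bigr => k _.
by rewrite -scalerAr mulrA; congr (_ *: (_ * _)); rewrite /= /tbracket subrK.
Qed.

(** For k > 0 the power x^k has no scalar part, so [dynkinM] gives D(x^(k+1)) = (ad x)^k (delta x).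
    The binomial expansion of delta(x^n) in these terms then sums to the claim. *)
Lemma texp_logder x : L x -> tdeg (texp x) = dynkin (texp x) * texp x.
Proof.
move=> Lx; have x1 := tord_lie Lx.
pose f k := if k is k'.+1 then iter k' (tbracket x) (tdeg x) else 0.
have Df k : dynkin (x ^+ k) = f k.
  elim: k => [|k IH]; first by rewrite dynkin1.
  rewrite exprS dynkinM IH theta_lie //.
  case: k {IH} => [|k] /=.
    by rewrite tcoef_one scale1r tbracket0 addr0 dynkin_lie.
  by rewrite tcoefX_small ?x1 // scale0r add0r.
rewrite {2}/texp /dynkin (wlin_sum _ _ (fun k => (k`!%:R)^-1) (fun k => x ^+ k)).
under [in RHS]eq_bigr => k _ do rewrite -/(dynkin _) Df.
rewrite -(texp_cauchy (f := f)) //; last first.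
  case=> [|k]; first exact: tord_leq0.
  by rewrite /f -[in tord _]addn1; apply: tord_iter_bracket => //; exact: tord_deg.
have -> : tdeg (texp x) = \sum_(n < m.+1) (n`!%:R)^-1 *: tdeg (x ^+ n).
  rewrite /texp; elim: m.+1 => [|n IH]; first by rewrite !big_ord0 tdeg0.
  by rewrite !big_ord_recr /= addrC tdegD IH addrC.
apply: eq_bigr => n _; congr (_ *: _); elim: (n : nat) => [|{}n IH].
  by rewrite big_ord_recl big_ord0 addr0 bin0 scale1r mul0r tdeg1.
(* The term k = 0 is delta(x) x^n because [f 0 = 0]; the remaining ones form x delta(x^n). *)
rewrite pascal_sum exprS tdegM IH [in RHS]big_ord_recl [in LHS]big_ord_recl.
rewrite /= !bin0 !scale1r subn0 !mul0r addr0 add0r; congr (_ + _).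
rewrite mulr_sumr; apply: eq_bigr => k _.
by rewrite -scalerAr mulrA; congr (_ *: (_ * _)); rewrite /= /tbracket subrK.
Qed.

(** The difference of the (k+1)-st powers of x + c and x has order n + 1 + k, so only the linear
    term c survives modulo order n + 2. *)
Lemma texp_addn x c n : tord 1 x -> tord n.+1 c ->
  tord n.+2 (texp (x + c) - texp x - c).
Proof.
move=> x1 cn; have c1 : tord 1 c by apply: tordW cn.
have xc1 : tord 1 (x + c) by exact: tordD.
have oX k : tord (n.+1 + k) ((x + c) ^+ k.+1 - x ^+ k.+1).
  elim: k => [|k IH]; first by rewrite !expr1 addrAC subrr add0r addn0.
  have -> : (x + c) ^+ k.+2 - x ^+ k.+2 =
      (x + c) * ((x + c) ^+ k.+1 - x ^+ k.+1) + c * x ^+ k.+1.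
    by rewrite mulrBr -exprS [x ^+ k.+2]exprS mulrDl opprD addrA subrK.
  apply: tordD; first by rewrite addnS -add1n; exact: tordM.
  by apply: tordM => //; exact: tordX.
rewrite !texp_sum2 //.
have -> (u v : T) : 1 + (x + c + u) - (1 + (x + v)) - c = u - v.
  rewrite !opprD.
  rewrite [LHS](AC ((1*3)*(1*2)*1) ((1*5)*(2*6)*(3*8)*(4*7)))/= !subrr !add0r.
  by [].
rewrite -sumrB; apply: tord_sum => k _; rewrite -scalerBr; apply: tordZ.
by apply: tordW (oX k.+1); rewrite addnS -addSn leq_addr.
Qed.

(** If exp x agrees with h through degree n, the component of degree n + 1 of the remainder r agrees
    with that of D(r) / (n + 1), a Lie element; adding the latter to x gains one degree. *)
Lemma dynkin_group_exp h n : dynkin_group h ->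
  exists2 x, L x & tord n.+1 (h - texp x).
Proof.
move=> [h1 th dh]; elim: n => [|n [x Lx ohx]].
  exists 0; first exact: free_lie0.
  by apply/tord1; rewrite texp0 tcoefD tcoefN h1 tcoef_one subrr.
set e := texp x in ohx; set r := h - e in ohx.
have x1 := tord_lie Lx.
have n0 : (n.+1%:R : K) != 0 by rewrite pnatr_eq0.
exists (x + (n.+1%:R)^-1 *: dynkin r).
  by apply: free_lieD => //; apply: free_lieZ; exact: free_lie_dynkin.
set c := _ *: _; have oc : tord n.+1 c by apply: tordZ; exact: tord_dynkin.
have -> : h - texp (x + c) = (r - c) - (texp (x + c) - e - c).
  by rewrite !opprB /r !addrA [RHS](AC 6 (1*6*(3*4)*(2*5))) /= ?addNr ?addrN ?addr0.
apply: tordB; last exact: texp_addn.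
rewrite -[r](scalerK n0) -scalerBr; apply: tordZ.
have -> : n.+1%:R *: r - dynkin r = (n.+1%:R *: r - tdeg r) + (tdeg r - dynkin r).
  by rewrite addrA subrK.
apply: tordD.
  move=> s sn; rewrite tcoefD tcoefN tcoefZ tcoef_deg.
  move: sn; rewrite ltnS leq_eqVlt => /predU1P[->|sn]; first by rewrite subrr.
  by rewrite ohx // !mulr0 subrr.
(* The difference of the derivative equations of h and [e]. Each product pairs a factor of order n +
   1 with one of order 1. *)
have -> : tdeg r - dynkin r = dynkin r * (h - 1) + dynkin e * r.
  rewrite /r tdegB dh texp_logder // -/e dynkinB !mulrBr !mulrBl !mulr1.
  by rewrite [RHS](AC (3*2) ((1*5*3)*(2*4))) /= addNr addr0.
have h1' : tord 1 (h - 1) by apply/tord1; rewrite tcoefD tcoefN h1 tcoef_one subrr.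
apply: tordD; first by rewrite -addn1; apply: tordM => //; exact: tord_dynkin.
by rewrite -add1n; apply: tordM => //; apply: tord_lie; exact: free_lie_dynkin.
Qed.

(** For n = m the remainder in [dynkin_group_exp] has order m + 1 and vanishes. *)
Lemma free_groupP g : free_group g <-> dynkin_group g.
Proof.
split=> [[x Lx <-]|Hg].
  split; first exact/texp_nil/tord_lie.
  - by move=> y; exact: texp_conj.
  - exact: texp_logder.
have [x Lx ox] := dynkin_group_exp m Hg; exists x => //.
by apply/esym/eqP; rewrite -subr_eq0; apply/eqP/(tord_eq0 _ ox).
Qed.

Lemma free_group1 : free_group (1 : T).
Proof. by apply/free_groupP; exact: dynkin_group1. Qed.

Lemma free_groupM g h : free_group g -> free_group h -> free_group (g * h).
Proof. by rewrite !free_groupP; exact: dynkin_groupM. Qed.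

Lemma free_groupV g : free_group g -> free_group g^-1.
Proof. by rewrite !free_groupP; exact: dynkin_groupV. Qed.

Lemma free_group_nil g : free_group g -> tcoef g [::] = 1.
Proof. by rewrite free_groupP => -[]. Qed.

Lemma free_group_unit g : free_group g -> g \is a GRing.unit.
Proof. by move/free_group_nil/tunit1. Qed.

Lemma free_group_exp x : L x -> free_group (texp x).
Proof. by exists x. Qed.

(** For r = g - 1 the derivative equation reads delta r - D r = (D r) r, which has higher order; on
    the lowest component delta is multiplication by n + 1. *)
Lemma free_group_lowest g n : free_group g -> tord n.+1 (g - 1) ->
  tord n.+2 (g - 1 - (n.+1%:R)^-1 *: dynkin (g - 1)).
Proof.
move=> /free_groupP[g1 _ dg] og.
have n0 : (n.+1%:R : K) != 0 by rewrite pnatr_eq0.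
set r := g - 1; rewrite -{1}[r](scalerK n0) -scalerBr; apply: tordZ.
have -> : n.+1%:R *: r - dynkin r = (n.+1%:R *: r - tdeg r) + (tdeg r - dynkin r).
  by rewrite addrA subrK.
apply: tordD.
  move=> s sn; rewrite tcoefD tcoefN tcoefZ tcoef_deg.
  move: sn; rewrite ltnS leq_eqVlt => /predU1P[->|sn]; first by rewrite subrr.
  by rewrite og // !mulr0 subrr.
have -> : tdeg r - dynkin r = dynkin r * r.
  by rewrite /r tdegB dg tdeg1 subr0 dynkinB dynkin1 subr0 mulrBr mulr1.
rewrite -addn1; apply: tordM; first exact: tord_dynkin.
exact: tordW og.
Qed.

End FreeGroup.

(** * Dilations as algebra endomorphisms preserving the Lie algebra and the group *)

Section Dilation.
Variables (K : numFieldType) (V : vectType K) (m : nat).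
Notation T := (ttensor V m).
Implicit Types (a b x : T) (t : K).

Lemma tcoef_dilation t a s : tcoef (dilation t a) s = t ^+ size s * tcoef a s.
Proof.
by rewrite tcoef_mk; case: leqP => // ms; rewrite tcoef_out // mulr0.
Qed.

Lemma dilationD t k a b :
  dilation t (k *: a + b) = k *: dilation t a + dilation t b.
Proof.
apply/tensorP => s sm.
by rewrite tcoefD tcoefZ !tcoef_dilation tcoefD tcoefZ mulrDr mulrCA.
Qed.

Lemma dilation0 t : dilation t (0 : T) = 0.
Proof. by apply/tensorP => s sm; rewrite tcoef_dilation !tcoef0 mulr0. Qed.

Lemma dilationN t a : dilation t (- a) = - dilation t a.
Proof. by have := dilationD t (-1) a 0; rewrite dilation0 !addr0 !scaleN1r. Qed.

Lemma dilation1 t : dilation t (1 : T) = 1.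
Proof.
apply/tensorP => -[|i s] sm; rewrite tcoef_dilation tcoef_one ?mulr0 //.
by rewrite mulr1.
Qed.

Lemma dilationM t a b : dilation t (a * b) = dilation t a * dilation t b.
Proof.
apply/tensorP => s sm; rewrite tcoef_dilation !tcoef_mul // mulr_sumr.
apply: eq_bigr => i _; rewrite !tcoef_dilation mulrACA -exprD -size_cat.
by rewrite cat_take_drop.
Qed.

Lemma dilationX t a n : dilation t (a ^+ n) = dilation t a ^+ n.
Proof. by elim: n => [|n IH]; rewrite ?dilation1 // !exprS dilationM IH. Qed.

Lemma dilation_exp t x : dilation t (texp x) = texp (dilation t x).
Proof.
rewrite /texp; elim: m.+1 => [|n IH]; first by rewrite !big_ord0 dilation0.
by rewrite !big_ord_recr /= addrC dilationD IH dilationX addrC.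
Qed.

Lemma dilation_letter t i :
  dilation t (tword m [:: i] : T) = t *: tword m [:: i].
Proof.
apply/tensorP => s sm; rewrite tcoef_dilation tcoefZ tcoef_word //.
by case: eqP => [->|]; rewrite ?expr1 ?mulr0.
Qed.

Lemma dilation_bracket t a b :
  dilation t (tbracket a b) = tbracket (dilation t a) (dilation t b).
Proof.
rewrite /tbracket -[a * b]scale1r dilationD dilationN !dilationM.
by rewrite scale1r.
Qed.

Lemma dilation_rbracket t (w : seq (ordinal (\dim {:V}))) :
  dilation t (rbracket m w) = t ^+ size w *: rbracket m w.
Proof.
elim: w => [|i w IH]; first by rewrite dilation0 scaler0.
rewrite /=; case: w IH => [|j w] IH; first by rewrite dilation_letter.
rewrite [nilp _]/= dilation_bracket IH dilation_letter exprS -scalerA.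
rewrite /tbracket -!scalerAl -!scalerAr !scalerA.
by rewrite [X in _ - X *: _]mulrC -scalerBr.
Qed.

Lemma free_lie_dilation t a : free_lie a -> free_lie (dilation t a).
Proof.
move: a; apply: free_lie_ind => [|k a b La Lb|i|a b La Lb].
- rewrite dilation0; exact: free_lie0.
- by rewrite dilationD; apply: free_lieD => //; exact: free_lieZ.
- by rewrite dilation_letter; apply: free_lieZ; exact: free_lie_letter.
- by rewrite dilation_bracket; exact: free_lie_bracket.
Qed.

Lemma free_group_dilation t a : free_group a -> free_group (dilation t a).
Proof.
by case=> x Lx <-; rewrite dilation_exp; apply: free_group_exp; exact: free_lie_dilation.
Qed.

End Dilation.

(** * Coordinatewise convergence and continuity of the algebraic operations *)

Section Convergence.
Variables (R : realType) (V : vectType R) (m : nat).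
Notation T := (ttensor V m).
Notation G := (@free_group R V m).
Variables (X : Type) (F : set_system X).
Context {FF : Filter F}.
Implicit Types (a b : T) (u v : X -> T).

Lemma cvg_sumr (J : Type) (r : seq J) (f : J -> X -> R) (g : J -> R) :
  (forall j, f j @ F --> g j) ->
  (fun x => \sum_(j <- r) f j x) @ F --> \sum_(j <- r) g j.
Proof.
move=> fg; elim: r => [|j r IH].
  by rewrite big_nil; under eq_fun do rewrite big_nil; exact: cvg_cst.
by rewrite big_cons; under eq_fun do rewrite big_cons; exact: cvgD.
Qed.

(** The filter is arbitrary because sequences, ultrafilters and neighbourhoods within the unit
    interval all occur below. *)
Definition tcvg u a := forall s, (fun x => tcoef (u x) s) @ F --> tcoef a s.

Lemma tcvg_cst a : tcvg (fun=> a) a.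
Proof. by move=> s; exact: cvg_cst. Qed.

Lemma tcvgD u v a b : tcvg u a -> tcvg v b -> tcvg (fun x => u x + v x) (a + b).
Proof.
move=> ua vb s; rewrite tcoefD.
by under eq_fun do rewrite tcoefD; exact: cvgD.
Qed.

Lemma tcvgZ (c : X -> R) (k : R) u a : c @ F --> k -> tcvg u a ->
  tcvg (fun x => c x *: u x) (k *: a).
Proof.
move=> ck ua s; rewrite tcoefZ.
by under eq_fun do rewrite tcoefZ; exact: cvgM.
Qed.

Lemma tcvgN u a : tcvg u a -> tcvg (fun x => - u x) (- a).
Proof.
by move=> ua s; rewrite tcoefN; under eq_fun do rewrite tcoefN; exact: cvgN.
Qed.

Lemma tcvg_sum (J : Type) (r : seq J) (P : pred J) (f : J -> X -> T) g :
  (forall j, P j -> tcvg (f j) (g j)) ->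
  tcvg (fun x => \sum_(j <- r | P j) f j x) (\sum_(j <- r | P j) g j).
Proof.
move=> fg; elim: r => [|j r IH].
  by rewrite big_nil; under eq_fun do rewrite big_nil; exact: tcvg_cst.
rewrite big_cons; under eq_fun do rewrite big_cons.
by case: ifPn => // /fg fj; exact: tcvgD.
Qed.

Lemma tcvgM u v a b : tcvg u a -> tcvg v b -> tcvg (fun x => u x * v x) (a * b).
Proof.
move=> ua vb s; have [sm|ms] := leqP (size s) m; last first.
  by rewrite tcoef_out //; under eq_fun do rewrite tcoef_out //; exact: cvg_cst.
rewrite tcoef_mul //; under eq_fun do rewrite tcoef_mul //.
by apply: cvg_sumr => i; exact: cvgM.
Qed.

Lemma tcvg_prod (J : Type) (r : seq J) (P : pred J) (f : J -> X -> T) g :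
  (forall j, P j -> tcvg (f j) (g j)) ->
  tcvg (fun x => \prod_(j <- r | P j) f j x) (\prod_(j <- r | P j) g j).
Proof.
move=> fg; elim: r => [|j r IH].
  by rewrite big_nil; under eq_fun do rewrite big_nil; exact: tcvg_cst.
rewrite big_cons; under eq_fun do rewrite big_cons.
by case: ifPn => // /fg fj; exact: tcvgM.
Qed.

Lemma tcvgX u a n : tcvg u a -> tcvg (fun x => u x ^+ n) (a ^+ n).
Proof.
move=> ua; elim: n => [|n IH]; first exact: tcvg_cst.
by rewrite exprS; under eq_fun do rewrite exprS; exact: tcvgM.
Qed.

Lemma tcvg_exp u a : tcvg u a -> tcvg (fun x => texp (u x)) (texp a).
Proof.
move=> ua; apply: tcvg_sum => k _; apply: tcvgZ; first exact: cvg_cst.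
exact: tcvgX.
Qed.

(** On elements with scalar part 1 the inverse is thus a polynomial, which makes inversion
    continuous there. *)
Lemma tinv1E a : tcoef a [::] = 1 -> a^-1 = \sum_(k < m.+1) (1 - a) ^+ k.
Proof.
move=> a1; rewrite [LHS]/(tinv a) /tinv /tunit a1 oner_neq0 invr1 !scale1r.
by [].
Qed.

Lemma tcvgV u a : (forall x, tcoef (u x) [::] = 1) -> tcoef a [::] = 1 ->
  tcvg u a -> tcvg (fun x => (u x)^-1) a^-1.
Proof.
move=> u1 a1 ua; rewrite tinv1E //; under eq_fun do rewrite tinv1E //.
apply: tcvg_sum => k _; apply: tcvgX; apply: tcvgD; first exact: tcvg_cst.
exact: tcvgN.
Qed.

Lemma tcvg_wlin f u a : tcvg u a -> tcvg (fun x => wlin f (u x)) (wlin f a).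
Proof. by move=> ua; apply: tcvg_sum => w _; apply: tcvgZ => //; exact: tcvg_cst. Qed.

Lemma tcvg_deg u a : tcvg u a -> tcvg (fun x => tdeg (u x)) (tdeg a).
Proof.
move=> ua s; rewrite tcoef_deg; under eq_fun do rewrite tcoef_deg.
by apply: cvgM => //; exact: cvg_cst.
Qed.

End Convergence.

Lemma tcvg_unique (R : realType) (V : vectType R) (m : nat) (X : Type)
    (F : set_system X) (FF : ProperFilter F) (u : X -> ttensor V m) a b :
  tcvg F u a -> tcvg F u b -> a = b.
Proof.
move=> ua ub; apply/tensorP => s _.
by apply: (cvg_unique _ (ua s) (ub s)); exact: norm_hausdorff.
Qed.

(** The equations of [dynkin_group] equate continuous maps, so they survive limits. *)
Lemma free_group_closed (R : realType) (V : vectType R) (m : nat) (X : Type)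
    (F : set_system X) (FF : ProperFilter F) (u : X -> ttensor V m) a :
  (forall x, free_group (u x)) -> tcvg F u a -> free_group a.
Proof.
move=> Gu ua; apply/free_groupP; split.
- have := ua [::]; under eq_fun do rewrite (free_group_nil (Gu _)).
  move=> /cvg_unique; apply; [exact: norm_hausdorff|exact: cvg_cst].
- move=> y; apply: (@tcvg_unique _ _ _ _ F _ (fun x => theta (u x) y * u x)).
    by apply: tcvgM => //; exact: tcvg_wlin.
  have -> : (fun x => theta (u x) y * u x) = fun x => u x * y.
    by apply/funext => x; case/free_groupP: (Gu x).
  by apply: tcvgM => //; exact: tcvg_cst.
- apply: (@tcvg_unique _ _ _ _ F _ (fun x => tdeg (u x))); first exact: tcvg_deg.
  have -> : (fun x => tdeg (u x)) = fun x => dynkin (u x) * u x.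
    by apply/funext => x; case/free_groupP: (Gu x).
  by apply: tcvgM => //; exact: tcvg_wlin.
Qed.

(** * Homogeneous norms: coordinate convergence to 1 implies convergence in norm *)

Section HomogeneousNorm.
Variables (R : realType) (V : normedVectType R) (m : nat).
Notation T := (ttensor V m).
Notation G := (@free_group R V m).
Notation word := (m.-bseq (ordinal (\dim {:V}))).
Variable N : T -> R.
Hypothesis hN : homogeneous_norm N.
Implicit Types (a b g h z : T).

Lemma gnorm_ge0 g : G g -> 0 <= N g.
Proof. by case: hN => + _ _ _ _; exact. Qed.

Lemma gnorm_eq0 g : G g -> N g = 0 <-> g = 1.
Proof. by case: hN => _ + _ _ _; exact. Qed.

Lemma gnorm_dilation t g : G g -> N (dilation t g) = `|t| * N g.
Proof. by case: hN => _ _ + _ _; exact. Qed.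

Lemma gnormM g h : G g -> G h -> N (g * h) <= N g + N h.
Proof. by case: hN => _ _ _ + _; exact. Qed.

Lemma gnormV g : G g -> N g^-1 = N g.
Proof. by case: hN => _ _ _ _; exact. Qed.

Lemma gnorm1 : N 1 = 0.
Proof. by apply/(gnorm_eq0 (@free_group1 _ _ _)). Qed.

Lemma norm_prod (J : Type) (r : seq J) (P : pred J) (f : J -> T) :
    (forall j, P j -> G (f j)) ->
  G (\prod_(j <- r | P j) f j) /\
  N (\prod_(j <- r | P j) f j) <= \sum_(j <- r | P j) N (f j).
Proof.
move=> Gf; elim/big_rec2: _ => [|j y z Pj [Gz Nz]].
  by rewrite gnorm1; split => //; exact: free_group1.
split; first by apply: free_groupM => //; exact: Gf.
by apply: le_trans (gnormM (Gf _ Pj) Gz) _; rewrite lerD2l.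
Qed.

(** According to the sign of k, [k *: z] is the dilation of z or of -z by |k|^(1/(n+1)); the sum of
    the two norms covers both cases. *)
Lemma norm_exp_homogeneous z n k : free_lie z ->
    (forall t, dilation t z = t ^+ n.+1 *: z) ->
  N (texp (k *: z)) <= `|k| `^ n.+1%:R^-1 * (N (texp z) + N (texp (- z))).
Proof.
move=> Lz dz; set r := _ `^ _.
have rk : r ^+ n.+1 = `|k|.
  by rewrite -powR_mulrn ?powR_ge0 // -powRrM mulVf ?powRr1 // pnatr_eq0.
have LNz : free_lie (- z) by rewrite -scaleN1r; exact: free_lieZ.
have [Gz GNz] := (free_group_exp Lz, free_group_exp LNz).
have r0 : `|r| = r by rewrite ger0_norm // powR_ge0.
have [k0|k0] := leP 0 k.
  have -> : k *: z = dilation r z by rewrite dz rk ger0_norm.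
  rewrite -dilation_exp gnorm_dilation // r0.
  by rewrite ler_wpM2l ?powR_ge0 // lerDl gnorm_ge0.
have -> : k *: z = dilation r (- z).
  by rewrite dilationN dz rk ltr0_norm // scaleNr opprK.
rewrite -dilation_exp gnorm_dilation // r0.
by rewrite ler_wpM2l ?powR_ge0 // lerDr gnorm_ge0.
Qed.

(** Each factor is 1 plus a term of order n + 1, and products of two such terms have order 2n + 2,
    so the exponents simply add modulo order n + 2. *)
Lemma prod_exp_ord (r : seq word) (c : word -> R) n :
  let P w := size (w : seq _) == n.+1 in
  tord n.+1 (\prod_(w <- r | P w) texp (c w *: rbracket m w) - 1 : T) /\
  tord n.+2 (\prod_(w <- r | P w) texp (c w *: rbracket m w) - 1 -
             \sum_(w <- r | P w) c w *: rbracket m w : T).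
Proof.
move=> P.
suff [] : [/\ tord n.+1 (\prod_(w <- r | P w) texp (c w *: rbracket m w) - 1 : T),
  tord n.+1 (\sum_(w <- r | P w) c w *: rbracket m w : T) &
  tord n.+2 (\prod_(w <- r | P w) texp (c w *: rbracket m w) - 1 -
             \sum_(w <- r | P w) c w *: rbracket m w : T)] by [].
elim/big_rec2: _ => [|w s v /eqP sw [ov os ovs]].
  by rewrite subrr subr0; split; exact: tord0.
have oz : tord n.+1 (c w *: rbracket m w : T).
  by apply: tordZ; rewrite -sw; exact: tord_rbracket.
have oe : tord n.+2 (texp (c w *: rbracket m w) - 1 - c w *: rbracket m w : T).
  by have := texp_addn (@tord0 _ _ _ 1) oz; rewrite add0r texp0.
set e := texp _ in oe *; set z := c w *: _ in oz oe *.
have oe1 : tord n.+1 (e - 1).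
  by rewrite -[e - 1](subrK z); apply: tordD => //; exact: tordW oe.
have eq1 : e * v - 1 = (e - 1) * (v - 1) + ((e - 1) + (v - 1)).
  rewrite mulrBl mulrBr mulr1 mul1r.
  by rewrite [RHS](AC (3*3) ((1*5)*(4*2)*(6*3))) /= !subrr !addr0.
split.
- rewrite eq1; apply: tordD; last exact: tordD.
  by apply: (@tordW _ _ _ (n.+1 + n.+1)); [lia|exact: tordM].
- exact: tordD.
have -> : e * v - 1 - (z + s) = (e - 1) * (v - 1) + ((e - 1 - z) + (v - 1 - s)).
  by rewrite eq1 -addrA; congr (_ + _); rewrite opprD addrACA.
apply: tordD; last exact: tordD.
by apply: (@tordW _ _ _ (n.+1 + n.+1)); [lia|exact: tordM].
Qed.

(** By [free_group_lowest], modulo order n + 2, g - 1 is the combination of the [rbracket m w] over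
    words of length n + 1 with coefficients [- c w]; the product of exponentials cancels it. *)
Lemma free_group_peel g n : G g -> tord n.+1 (g - 1) ->
  let c (w : word) := - (n.+1%:R^-1 * tcoef g w) in
  tord n.+2 (\prod_(w : word | size (w : seq _) == n.+1)
                texp (c w *: rbracket m w) * g - 1).
Proof.
move=> Gg og c; have [] := prod_exp_ord (index_enum _) c n.
set v := \prod_(w | _) _; set s := \sum_(w | _) _ => ov ovs.
have og2 := free_group_lowest Gg og.
(* A product of order 2n + 2, two errors of order n + 2, and the linear terms, which cancel on words
   of length n + 1. *)
have -> : v * g - 1 = (v - 1) * (g - 1) + ((v - 1 - s) +
    (g - 1 - n.+1%:R^-1 *: dynkin (g - 1)) +
    (s + n.+1%:R^-1 *: dynkin (g - 1))).
  rewrite [X in _ = _ + X](AC (2*2*2) ((1*3)*(5*2)*(6*4))) /= !subrr !addr0.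
  rewrite mulrBl mulrBr mulr1 mul1r.
  by rewrite [RHS](AC (3*3) ((1*5)*(4*2)*(6*3))) /= !subrr !addr0.
apply: tordD.
  by apply: (@tordW _ _ _ (n.+1 + n.+1)); [lia|exact: tordM].
apply: tordD; first exact: tordD.
rewrite /s big_mkcond /= /dynkin /wlin scaler_sumr -big_split /=.
apply: tord_sum => w _; have [wn|wn] := eqVneq (size (w : seq _)) n.+1.
  rewrite scalerA -scalerDl /c tcoefD tcoefN tcoef_one.
  by rewrite /nilp wn subr0 addNr scale0r; exact: tord0.
rewrite add0r; apply: tordZ; have [wn'|nw] := ltnP (size (w : seq _)) n.+1.
  by rewrite og // scale0r; exact: tord0.
apply: tordZ; apply: (@tordW _ _ _ (size (w : seq _))); last exact: tord_rbracket.
by rewrite ltn_neqAle eq_sym wn.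
Qed.

Lemma powR_cvg0 (X : Type) (F : set_system X) (FF : Filter F) (c : X -> R) (r : R) :
  0 < r -> c @ F --> 0 -> `|c x| `^ r @[x --> F] --> 0.
Proof.
move=> r0 c0; apply/cvgr0Pnorm_lt => e e0.
have er : 0 < e `^ r^-1 by exact: powR_gt0.
have /cvgr0Pnorm_lt/(_ _ er) := c0.
apply: filterS => x cx; rewrite ger0_norm ?powR_ge0 //.
have -> : e = (e `^ r^-1) `^ r by rewrite -powRrM mulVf ?gt_eqF // powRr1 // ltW.
by apply: gt0_ltr_powR => //; rewrite nnegrE ?powR_ge0.
Qed.

Lemma squeeze_cvg0 (X : Type) (F : set_system X) (FF : Filter F) (f1 f2 : X -> R) :
  (forall x, 0 <= f1 x <= f2 x) -> f2 @ F --> 0 -> f1 @ F --> 0.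
Proof.
move=> fg g0; apply: (@squeeze_cvgr _ _ _ _ (cst 0) f2) => //.
  exact: nearW.
exact: cvg_cst.
Qed.

Lemma tcvg1_norm (X : Type) (F : set_system X) (FF : Filter F) (u : X -> T) :
  (forall x, G (u x)) -> tcvg F u 1 -> N (u x) @[x --> F] --> 0.
Proof.
(* Induction on k, a bound for the number of degrees still to be peeled off; for k = 0 the order
   exceeds m and [u x] is 1. *)
suff main k n : (m <= n + k)%N -> forall u : X -> T, (forall x, G (u x)) ->
    (forall x, tord n.+1 (u x - 1)) -> tcvg F u 1 -> N (u x) @[x --> F] --> 0.
  move=> Gu; apply: (main m 0) => // x; apply/tord1.
  by rewrite tcoefD tcoefN free_group_nil // tcoef_one subrr.
elim: k n => [|k IH] n mnk {}u Gu ou u1.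
  have -> : (fun x => N (u x)) = fun=> 0.
    apply/funext => x; rewrite -gnorm1; congr N; apply/eqP; rewrite -subr_eq0.
    by apply/eqP/(tord_eq0 _ (ou x)); rewrite ltnS -[n]addn0.
  exact: cvg_cst.
pose c x (w : word) := - (n.+1%:R^-1 * tcoef (u x) w).
pose e x (w : word) : T := texp (c x w *: rbracket m w).
pose v x : T := \prod_(w : word | size (w : seq _) == n.+1) e x w.
have Lrb (w : word) : free_lie (rbracket m w : T) by exact: free_lie_rbracket.
have Ge x w : G (e x w) by apply: free_group_exp; apply: free_lieZ.
have c0 (w : word) : size (w : seq _) == n.+1 -> c x w @[x --> F] --> 0.
  move=> /eqP sw; rewrite -[X in _ --> X]oppr0 -(mulr0 n.+1%:R^-1).
  apply: cvgN; apply: cvgM; first exact: cvg_cst.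
  by have := u1 w; rewrite tcoef_one /nilp sw.
have Gv x : G (v x).
  by case: (norm_prod (P := fun w : word => size (w : seq _) == n.+1)
    (index_enum _) (fun w _ => Ge x w)).
have v1 : tcvg F v 1.
  rewrite [1](_ : _ = \prod_(w : word | size (w : seq _) == n.+1) 1 :> T); last first.
    by rewrite big1.
  apply: tcvg_prod => w sw; rewrite -texp0; apply: tcvg_exp.
  rewrite -(scale0r (rbracket m w)); apply: tcvgZ; first exact: c0.
  exact: tcvg_cst.
have vu0 : N (v x * u x) @[x --> F] --> 0.
  apply: (IH n.+1); first by rewrite addSnnS.
  - by move=> x; exact: free_groupM.
  - by move=> x; exact: free_group_peel.
  - by rewrite -[1]mulr1; exact: tcvgM.
pose M (w : word) := N (texp (rbracket m w)) + N (texp (- rbracket m w)).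
(* The majorant comes from u = v^-1 (v u): the first sum bounds N(v) factor by factor, and the
   second term is the induction hypothesis. *)
apply: (@squeeze_cvg0 _ _ _ _ (fun x =>
  \sum_(w : word) (if size (w : seq _) == n.+1
                   then `|c x w| `^ n.+1%:R^-1 * M w else 0) + N (v x * u x))).
- move=> x; rewrite gnorm_ge0 //=.
  rewrite -{1}(mulKr (free_group_unit (Gv x)) (u x)).
  apply: le_trans (gnormM _ _) _; [exact: free_groupV|exact: free_groupM|].
  rewrite lerD2r gnormV // -big_mkcond /=.
  have [_ /le_trans] := norm_prod (P := fun w : word => size (w : seq _) == n.+1)
    (index_enum _) (fun w _ => Ge x w).
  apply; apply: ler_sum => w /eqP sw; apply: norm_exp_homogeneous => // t.
  by rewrite dilation_rbracket sw.
rewrite -[X in _ --> X]addr0; apply: cvgD => //.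
rewrite [X in _ --> X](_ : _ = \sum_(w : word) (0 : R)); last by rewrite big1.
apply: (@cvg_sumr R X F _ word) => w.
have [sw|_] := boolP (size (w : seq _) == n.+1); last exact: cvg_cst.
rewrite -(mul0r (M w)); apply: cvgM; last exact: cvg_cst.
by apply: powR_cvg0; [rewrite invr_gt0 ltr0n|exact: c0].
Qed.

(** * Coordinate l1 norm, compactness by ultrafilters, and completeness of the group *)

Definition tnorm1 a : R := \sum_(w : word) `|tcoef a w|.

Lemma tcoef_le_norm1 a s : `|tcoef a s| <= tnorm1 a.
Proof.
have [sm|/tcoef_out ->] := leqP (size s) m; last first.
  by rewrite normr0 sumr_ge0.
by rewrite /tnorm1 (bigD1 (Bseq sm)) //= lerDl sumr_ge0.
Qed.

Lemma tcvg_norm1 (X : Type) (F : set_system X) (FF : Filter F) (u : X -> T) a :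
  tcvg F u a -> tnorm1 (u x) @[x --> F] --> tnorm1 a.
Proof. by move=> ua; apply: cvg_sumr => w; apply: cvg_norm; exact: ua. Qed.

Lemma bounded_ultra_cvg (F : set_system nat) (FU : UltraFilter F) (f : nat -> R) (C : R) :
  (forall k, `|f k| <= C) -> exists l : R, f @ F --> l.
Proof.
move=> fC; have FP := @ultra_proper _ _ FU.
have fF : (f @ F) [set` `[- C, C]].
  by apply: (@filterE _ F) => k; rewrite /= in_itv /= -ler_norml.
have [l [_ cl]] := segment_compact (fmap_proper_filter f FP) fF.
exists l => A Al /=; have [//|nA] := in_ultra_setVsetC (f @^-1` A) FU.
have [x [nAx Ax]] := cl (~` A) A nA Al.
by [].
Qed.

(** A single ultrafilter makes all coordinates converge at once, in place of successive extractions
    of subsequences. *)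
Lemma ultra_tcvg (F : set_system nat) (FU : UltraFilter F) (u : nat -> T) (C : R) :
  (forall k, tnorm1 (u k - 1) <= C) -> exists a, tcvg F u a.
Proof.
move=> uC; have FP := @ultra_proper _ _ FU.
have lP s : exists l : R, (fun k => tcoef (u k) s) @ F --> l.
  apply: (@bounded_ultra_cvg _ FU _ (C + `|tcoef (1 : T) s|)) => k.
  have -> : tcoef (u k) s = tcoef (u k - 1) s + tcoef (1 : T) s.
    by rewrite tcoefD tcoefN subrK.
  apply: le_trans (ler_normD _ _) _; rewrite lerD2r.
  exact: le_trans (tcoef_le_norm1 _ _) (uC k).
have [l ul] := choice lP.
exists (mktensor m l) => s; rewrite tcoef_mk; case: leqP => // ms.
by under eq_fun do rewrite tcoef_out //; exact: cvg_cst.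
Qed.

Lemma dilation_continuous g (t0 : R) : tcvg (nbhs t0) (fun t => dilation t g) (dilation t0 g).
Proof.
move=> s; rewrite tcoef_dilation; under eq_fun do rewrite tcoef_dilation.
by apply: cvgM; [exact: exprn_continuous|exact: cvg_cst].
Qed.

(** Intermediate value theorem along the dilations of g, which join 1 at t = 0 to g at t = 1. *)
Lemma norm1_dilation g (e : R) : G g -> 0 < e -> e <= tnorm1 (g - 1) ->
  exists2 t : R, 0 <= t <= 1 & tnorm1 (dilation t g - 1) = e.
Proof.
move=> Gg e0 eg.
have d0 : dilation 0 g = 1.
  apply/tensorP => -[|i s] _; rewrite tcoef_dilation tcoef_one.
    by rewrite free_group_nil // mulr1.
  by rewrite expr0n mul0r.
have d1 : dilation 1 g = g.
  by apply/tensorP => s _; rewrite tcoef_dilation expr1n mul1r.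
have n0 : tnorm1 0 = 0 by apply: big1 => w _; rewrite tcoef0 normr0.
have [||t] := @IVT R (fun t => tnorm1 (dilation t g - 1)) 0 1 e ler01.
- apply: continuous_subspaceT => t; apply: tcvg_norm1.
  apply: tcvgD; first exact: dilation_continuous.
  exact: tcvg_cst.
- rewrite d0 d1 subrr n0; apply/andP; split.
    by rewrite ge_min (ltW e0).
  by rewrite le_max eg orbT.
by rewrite in_itv /= => t01 te; exists t.
Qed.

(** Otherwise group elements of norm tending to 0 can be dilated onto the coordinate sphere of
    radius e around 1; an ultrafilter limit lies on the sphere and yet has norm 0. *)
Lemma norm_small (e : R) : 0 < e ->
  exists2 c : R, 0 < c & forall g, G g -> N g < c -> tnorm1 (g - 1) < e.
Proof.
move=> e0; apply: contrapT => noc.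
have uP (k : nat) : exists g, [/\ G g, N g < k.+1%:R^-1 & tnorm1 (g - 1) = e].
  apply: contrapT => nog; apply: noc; exists k.+1%:R^-1.
    by rewrite invr_gt0 ltr0n.
  move=> g Gg Ng; rewrite ltNge; apply/negP => eg; apply: nog.
  (* Since t is at most 1, the dilation does not increase the norm. *)
  have [t /andP[t0 t1] te] := norm1_dilation Gg e0 eg.
  exists (dilation t g); split => //; first exact: free_group_dilation.
  rewrite gnorm_dilation // ger0_norm //; apply: le_lt_trans Ng.
  by rewrite ler_piMl // gnorm_ge0.
have [u uE] := choice uP.
have Gu k : G (u k) by case: (uE k).
have [F [FU leF]] := ultraFilterLemma eventually_filter.
have FP := @ultra_proper _ _ FU.
have [a ua] : exists a, tcvg F u a.
  by apply: (@ultra_tcvg F FU u e) => k; case: (uE k) => _ _ ->.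
have Ga : G a := free_group_closed FP Gu ua.
have Nu : N (u k) @[k --> F] --> 0.
  apply: (@squeeze_cvg0 _ _ _ _ (fun k => k.+1%:R^-1)) => [k|].
    by rewrite gnorm_ge0 //=; case: (uE k) => _ /ltW.
  by move=> A /(@cvg_harmonic R); exact: leF.
have uVa : N ((u k)^-1 * a) @[k --> F] --> 0.
  apply: tcvg1_norm => [k|]; first by apply: free_groupM => //; exact: free_groupV.
  rewrite -(mulVr (free_group_unit Ga)); apply: tcvgM; last exact: tcvg_cst.
  by apply: tcvgV => //; [move=> k|]; exact: free_group_nil.
(* Subadditivity bounds N(a) by N(u_k) + N(u_k^-1 a); the last term tends to 0 by [tcvg1_norm], so
   the norm itself is never passed to the limit. *)
have Na : (fun _ : nat => N a) @ F --> 0.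
  apply: (@squeeze_cvg0 _ _ _ _ (fun k => N (u k) + N ((u k)^-1 * a))) => [k|].
    rewrite gnorm_ge0 //= -{1}(mulVKr (free_group_unit (Gu k)) a).
    by apply: gnormM => //; apply: free_groupM => //; exact: free_groupV.
  by rewrite -[X in _ --> X]addr0; exact: cvgD.
have a1 : a = 1.
  by apply/(gnorm_eq0 Ga); apply: (cvg_unique _ (cvg_cst (N a)) Na); exact: norm_hausdorff.
have : e = 0.
  have e_n : tnorm1 (u k - 1) @[k --> F] --> tnorm1 (a - 1).
    by apply: tcvg_norm1; apply: tcvgD => //; exact: tcvg_cst.
  have ce : tnorm1 (u k - 1) @[k --> F] --> e.
    have -> : (fun k => tnorm1 (u k - 1)) = fun=> e.
      by apply/funext => k; case: (uE k).
    exact: cvg_cst.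
  have -> : e = tnorm1 (a - 1).
    by apply: (cvg_unique _ ce e_n); exact: norm_hausdorff.
  rewrite a1 subrr.
  by apply: big1 => w _; rewrite tcoef0 normr0.
by move=> e00; rewrite e00 ltxx in e0.
Qed.

Lemma norm_tcvg1 (X : Type) (F : set_system X) (FF : Filter F) (u : X -> T) :
  (forall x, G (u x)) -> N (u x) @[x --> F] --> 0 -> tcvg F u 1.
Proof.
move=> Gu Nu s; apply/cvgrPdist_lt => e e0.
have [c c0 Nc] := norm_small e0.
have /cvgr0Pnorm_lt/(_ _ c0) := Nu; apply: filterS => x.
rewrite ger0_norm ?gnorm_ge0 // => /(Nc _ (Gu x)); apply: le_lt_trans.
by rewrite distrC -tcoefN -tcoefD tcoef_le_norm1.
Qed.

(** Translated by the inverse of one term, a tail stays in the coordinate unit ball around 1 and has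
    an ultrafilter limit; the Cauchy property makes it the limit of the whole sequence. *)
Lemma norm_complete (u : nat -> T) : (forall k, G (u k)) ->
    (forall e : R, 0 < e -> exists M, forall i j, (M <= i)%N -> (M <= j)%N ->
      N ((u i)^-1 * u j) <= e) ->
  exists2 a, G a & N ((u k)^-1 * a) @[k --> \oo] --> 0.
Proof.
move=> Gu cu; have [c c0 Nc] := norm_small ltr01.
(* Half of c, because the Cauchy bound is weak while [norm_small] asks for a strict one. *)
have [M uM] := cu (c / 2) (divr_gt0 c0 (ltr0Sn _ 1)).
have [F [FU leF]] := ultraFilterLemma eventually_filter.
have FP := @ultra_proper _ _ FU.
have GVu i j : G ((u i)^-1 * u j) by apply: free_groupM => //; exact: free_groupV.
have [b ub] : exists b, tcvg F (fun k => (u M)^-1 * u (k + M)%N) b.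
  apply: (@ultra_tcvg F FU _ 1) => k; apply/ltW/Nc => //.
  apply: le_lt_trans (uM _ _ _ _) _; rewrite ?leq_addl // ltr_pdivrMr //.
  by rewrite ltr_pMr // ltr1n.
pose a := u M * b.
have ua : tcvg F (fun k => u (k + M)%N) a.
  have -> : (fun k => u (k + M)%N) = fun k => u M * ((u M)^-1 * u (k + M)%N).
    by apply/funext => k; rewrite mulVKr // free_group_unit.
  by apply: tcvgM => //; exact: tcvg_cst.
have Ga : G a by apply: (free_group_closed FP (u := fun k => u (k + M)%N)).
exists a => //.
have uVa : N ((u (k + M)%N)^-1 * a) @[k --> F] --> 0.
  apply: tcvg1_norm => [k|]; first by apply: free_groupM => //; exact: free_groupV.
  rewrite -(mulVr (free_group_unit Ga)); apply: tcvgM; last exact: tcvg_cst.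
  by apply: tcvgV => //; [move=> k|]; exact: free_group_nil.
apply/cvgr0Pnorm_lt => e e0.
have [M' uM'] := cu (e / 2) (divr_gt0 e0 (ltr0Sn _ 1)).
have FM' : F [set k | (M' <= k)%N] by apply: leF; exists M'.
have /cvgr0Pnorm_lt/(_ _ (divr_gt0 e0 (ltr0Sn _ 1))) Fe := uVa.
(* One index beyond [M'] and close to the limit serves as intermediate point for every later i. *)
have [k [/= M'k Nk]] := filter_ex (filterI FM' Fe).
exists M' => // i /= M'i.
have Gia : G ((u i)^-1 * a) by apply: free_groupM => //; exact: free_groupV.
rewrite ger0_norm ?gnorm_ge0 //.
have -> : (u i)^-1 * a = (u i)^-1 * u (k + M)%N * ((u (k + M)%N)^-1 * a).
  by rewrite -mulrA mulVKr // free_group_unit.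
have Gka : G ((u (k + M)%N)^-1 * a) by apply: free_groupM => //; exact: free_groupV.
apply: le_lt_trans (gnormM _ _) _ => //.
rewrite ger0_norm ?gnorm_ge0 // in Nk.
rewrite [e]splitr; apply: ler_ltD => //; apply: uM' => //.
by rewrite (leq_trans M'k) ?leq_addr.
Qed.

End HomogeneousNorm.

(** * The path space: metric axioms, continuity from control bounds, completeness *)

Section RoughPathSpace.
Variables (R : realType) (V : normedVectType R) (m : nat).
Notation T := (ttensor V m).
Notation G := (@free_group R V m).
Variables (N : T -> R) (omega : R -> R -> R) (p : R).
Hypotheses (hN : homogeneous_norm N) (hp : 1 <= p) (homega : control omega).
Hypothesis omega_pos : forall s t : R, 0 <= s -> s < t -> t <= 1 -> 0 < omega s t.
Implicit Types (x y z : R -> T).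

Definition gpath x := forall t : R, t \in `[0, 1] -> G (x t).

Lemma mem_itv01 (s t : R) : 0 <= s -> s < t -> t <= 1 ->
  (s \in `[0, 1]) * (t \in `[0, 1]).
Proof.
by move=> s0 st t1; rewrite !in_itv /= s0 t1 (le_trans s0) ?(ltW st) //= (ltW (lt_le_trans st t1)).
Qed.

Lemma gpath_incr x s t : gpath x -> s \in `[0, 1] -> t \in `[0, 1] ->
  G (increment x s t).
Proof. by move=> Gx s1 t1; apply: free_groupM; [apply: free_groupV|]; exact: Gx. Qed.

Lemma gpath1 : gpath (fun=> 1).
Proof. by move=> t _; exact: free_group1. Qed.

Lemma C_omega_gpath x : C_omega N omega p x -> gpath x.
Proof. by case=> -[]. Qed.

(** Positivity of omega off the diagonal allows the denominators to be cleared in the supremum. *)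
Lemma d_omegaP x y (e : R) : (d_omega N omega p x y <= e%:E)%E <->
  (forall s t : R, 0 <= s -> s < t -> t <= 1 ->
    d_group N (increment x s t) (increment y s t) <= e * omega s t `^ p^-1).
Proof.
split=> [de s t s0 st t1|de].
  rewrite -ler_pdivrMr ?powR_gt0 ?omega_pos // -lee_fin.
  by apply: le_trans de; apply: ereal_sup_ubound; exists s, t.
apply: ge_ereal_sup => _ [s [t [s0 st t1 ->]]].
by rewrite lee_fin ler_pdivrMr ?powR_gt0 ?omega_pos // de.
Qed.

Lemma d_group_sym g h : G g -> G h -> d_group N g h = d_group N h g.
Proof.
move=> Gg Gh; rewrite /d_group -(gnormV hN); last first.
  by apply: free_groupM => //; exact: free_groupV.
by rewrite invrM ?unitrV ?free_group_unit // invrK.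
Qed.

Lemma d_group_tri g h k : G g -> G h -> G k ->
  d_group N g k <= d_group N g h + d_group N h k.
Proof.
move=> Gg Gh Gk; rewrite /d_group.
have -> : g^-1 * k = (g^-1 * h) * (h^-1 * k).
  by rewrite -mulrA mulVKr // free_group_unit.
by apply: (gnormM hN); apply: free_groupM => //; exact: free_groupV.
Qed.

Lemma d_group_ge0 g h : G g -> G h -> 0 <= d_group N g h.
Proof.
by move=> Gg Gh; apply: (gnorm_ge0 hN); apply: free_groupM => //; exact: free_groupV.
Qed.

(** The pair (0, 1) provides a nonnegative member; the supremum of an empty set would be -oo. *)
Lemma d_omega_ge0 x y : gpath x -> gpath y -> (0 <= d_omega N omega p x y)%E.
Proof.
move=> Gx Gy; have [i0 i1] := mem_itv01 (lexx (0 : R)) ltr01 (lexx 1).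
have {i0 i1}d0 : (0%:E <= (d_group N (increment x 0 1) (increment y 0 1)
    / omega 0 1 `^ p^-1)%:E)%E.
  rewrite lee_fin; apply: divr_ge0; last exact: powR_ge0.
  by apply: d_group_ge0; exact: gpath_incr.
apply: le_trans d0 _; apply: ereal_sup_ubound.
by exists 0, 1; rewrite ltr01.
Qed.

Lemma d_omega_sym x y : gpath x -> gpath y ->
  d_omega N omega p x y = d_omega N omega p y x.
Proof.
move=> Gx Gy; congr ereal_sup; apply/seteqP; split=> r [s [t [s0 st t1 ->]]];
  have [i0 i1] := mem_itv01 s0 st t1;
  exists s, t; rewrite d_group_sym //; exact: gpath_incr.
Qed.

Lemma d_omega_tri x y z : gpath x -> gpath y -> gpath z ->
  (d_omega N omega p x z <= d_omega N omega p x y + d_omega N omega p y z)%E.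
Proof.
move=> Gx Gy Gz; apply: ge_ereal_sup => _ [s [t [s0 st t1 ->]]].
have [i0 i1] := mem_itv01 s0 st t1.
pose q u v := (d_group N (increment u s t) (increment v s t) / omega s t `^ p^-1)%:E.
apply: (@le_trans _ _ (q x y + q y z)%E).
  rewrite -EFinD lee_fin -mulrDl ler_wpM2r ?invr_ge0 ?powR_ge0 //.
  by apply: d_group_tri; exact: gpath_incr.
by apply: leeD; apply: ereal_sup_ubound; exists s, t.
Qed.

(** Finiteness goes through the constant path 1. Separation reads the increments from time 0, where
    all paths equal 1. *)
Lemma C_omega_metric : metric_on (C_omega N omega p)
  (fun x y => forall t : R, t \in `[0, 1] -> x t = y t) (d_omega N omega p).
Proof.
split=> [x y|x y|x y|x y z] Cx Cy.
- have [Gx Gy] := (C_omega_gpath Cx, C_omega_gpath Cy).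
  rewrite d_omega_ge0 //=; apply: le_lt_trans (d_omega_tri Gx gpath1 Gy) _.
  rewrite (d_omega_sym gpath1) //; apply: lte_add_pinfty; first by case: Cx.
  by case: Cy.
- have [Gx Gy] := (C_omega_gpath Cx, C_omega_gpath Cy).
  split=> [d0 t t01|xy].
    case: Cx Cy => -[_ x0 _] _ [[_ y0 _] _].
    have := t01; rewrite in_itv /= => /andP[].
    rewrite le_eqVlt => /predU1P[<- _|tpos t1]; first by rewrite x0 y0.
    have : (d_omega N omega p x y <= 0%:E)%E by rewrite d0.
    move=> /d_omegaP/(_ 0 t (lexx 0) tpos t1).
    rewrite mul0r /increment x0 y0 invr1 !mul1r => dle.
    have /(gnorm_eq0 hN) : G ((x t)^-1 * y t).
      by apply: free_groupM; [apply: free_groupV|]; [exact: Gx|exact: Gy].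
    case=> h _; rewrite -[y t](mulVKr (free_group_unit (Gx t t01))) h ?mulr1 //.
    apply/eqP; rewrite eq_le; apply/andP; split; first exact: dle.
    by apply: d_group_ge0; [exact: Gx|exact: Gy].
  apply/eqP; rewrite eq_le d_omega_ge0 // andbT.
  apply/d_omegaP => s t s0 st t1; have [i0 i1] := mem_itv01 s0 st t1.
  rewrite mul0r /d_group /increment !xy // mulVr ?(gnorm1 hN) //.
  by apply: free_group_unit; apply: gpath_incr.
- by apply: d_omega_sym; exact: C_omega_gpath.
- by move=> Cz; apply: d_omega_tri; exact: C_omega_gpath.
Qed.

(** The minimum and maximum keep the pair in the simplex on both sides of t, so continuity of omega
    at (t, t) applies. *)
Lemma omega_cvg_diag (t : R) : t \in `[0, 1] ->
  omega (Num.min t s) (Num.max t s) @[s --> within [set` `[0, 1]] (nbhs t)] --> (0 : R).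
Proof.
move=> t01; have := t01; rewrite in_itv /= => /andP[t0 t1].
have [om _ om0 _] := homega.
have tt : simplex (t, t) by rewrite /simplex /= t0 t1 lexx.
have {}om : (fun st : R * R => omega st.1 st.2) @
    within (@simplex R) (nbhs (t, t)) --> (0 : R).
  by rewrite -(om0 t t0 t1); move/subspace_continuousP: om => /(_ _ tt).
move=> A /om [[U W] /= [tU tW] UW].
apply: (filterS _ (filterI tU tW)) => s [Us Ws] s01.
apply: (UW (Num.min t s, Num.max t s)).
  by case: (leP t s) => _; split => //=; exact: nbhs_singleton.
move: s01; rewrite /= in_itv /simplex /= => /andP[s0 s1].
by rewrite le_min ge_max t0 s0 t1 s1 /= ge_min le_max lexx.
Qed.

(** Write y_s = y_t y_{t,s}: the increment tends to 1 in norm by the bound, hence in coordinates by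
    [norm_tcvg1]. *)
Lemma holder_continuous y (C : R) : (forall t, G (y t)) ->
    (forall s t : R, 0 <= s -> s < t -> t <= 1 ->
      N (increment y s t) <= C * omega s t `^ p^-1) ->
  forall w, {within `[0, 1], continuous (fun t : R => tcoef (y t) w)}.
Proof.
move=> Gy yC w; apply/subspace_continuousP => t t01.
have := t01; rewrite /= in_itv /= => /andP[t0 t1].
suff yt : tcvg (within [set` `[0, 1]] (nbhs t)) y (y t) by exact: yt.
have -> : y = fun s => y t * increment y t s.
  by apply/funext => s; rewrite mulVKr // free_group_unit.
have Gi s u : G (increment y s u) by apply: free_groupM => //; exact: free_groupV.
rewrite [X in tcvg _ _ X](_ : _ = y t * 1); last first.
  by rewrite mulVKr ?mulr1 // free_group_unit.
apply: tcvgM; first exact: tcvg_cst.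
apply: (norm_tcvg1 hN) => //.
apply: (@squeeze_cvgr _ _ _ _ (cst 0)
  (fun s => C * `|omega (Num.min t s) (Num.max t s)| `^ p^-1)).
- rewrite near_withinE; apply: nearW => s; rewrite /= in_itv /= => /andP[s0 s1].
  rewrite (gnorm_ge0 hN) //=.
  have [ts|st|<-] := ltgtP t s.
  + rewrite ger0_norm ?yC //; apply/ltW/omega_pos => //.
  (* For s < t the increment is inverted to obtain an ordered pair, with the same norm. *)
  + rewrite ger0_norm; last exact/ltW/omega_pos.
    rewrite -(gnormV hN) // invrM ?unitrV ?free_group_unit // invrK.
    exact: yC.
  (* At s = t the bound is a power of 0, which is 0 because the exponent 1/p is nonzero. *)
  + rewrite /increment mulVr ?free_group_unit // (gnorm1 hN).
    have [_ _ om0 _] := homega.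
    by rewrite om0 // normr0 powR0 ?mulr0 // invr_neq0 // gt_eqF // (lt_le_trans ltr01).
- exact: cvg_cst.
- rewrite -[X in _ --> X](mulr0 C); apply: cvgM; first exact: cvg_cst.
  apply: powR_cvg0; first by rewrite invr_gt0 (lt_le_trans ltr01).
  exact: omega_cvg_diag.
Qed.

Lemma d_omega1_norm y s t (C : R) : (forall t, G (y t)) ->
    (d_omega N omega p y (fun=> 1%R) <= C%:E)%E ->
  0 <= s -> s < t -> t <= 1 -> N (increment y s t) <= C * omega s t `^ p^-1.
Proof.
move=> Gy /d_omegaP yC s0 st t1; have := yC s t s0 st t1.
rewrite /d_group /increment invr1 !mulr1 (gnormV hN) //.
by apply: free_groupM => //; exact: free_groupV.
Qed.

(** Paths start at 1, so their values are increments from 0 and converge pointwise in the group; the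
    Cauchy bound then passes to the limit on each pair (s, t). *)
Lemma C_omega_complete : complete_on (C_omega N omega p) (d_omega N omega p).
Proof.
move=> u Cu cu; have Gu n : gpath (u n) := C_omega_gpath (Cu n).
have u0 n : u n 0 = 1 by case: (Cu n) => -[].
have cauchy_t (t : R) : t \in `[0, 1] -> forall e : R, 0 < e ->
    exists M, forall i j, (M <= i)%N -> (M <= j)%N -> N ((u i t)^-1 * u j t) <= e.
  rewrite in_itv /= => /andP[t0 t1] e e0.
  move: t0; rewrite le_eqVlt => /predU1P[<-|t0].
    by exists 0 => i j _ _; rewrite !u0 invr1 mulr1 (gnorm1 hN) ltW.
  have w0 : 0 < omega 0 t `^ p^-1 by rewrite powR_gt0 // omega_pos.
  (* The threshold is e / omega(0,t)^(1/p), so that the bound on the increments from 0 to t is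
     exactly e. *)
  have [M uM] := cu _ (divr_gt0 e0 w0); exists M => i j Mi Mj.
  have /ltW/d_omegaP/(_ 0 t (lexx 0) t0 t1) := uM i j Mi Mj.
  by rewrite /d_group /increment !u0 invr1 !mul1r divfK // gt_eqF.
(* Outside the unit interval the value 1 is chosen, so that y is group-valued everywhere, as
   [holder_continuous] requires. *)
have yP (t : R) : exists a, G a /\ (t \in `[0, 1] ->
    N ((u k t)^-1 * a) @[k --> \oo] --> 0).
  have [t01|t01] := boolP (t \in `[0, 1]); last first.
    by exists 1; split; [exact: free_group1|].
  have [a Ga ua] := norm_complete hN (fun k => Gu k t t01) (cauchy_t t t01).
  by exists a.
have [y yE] := choice yP.
have Gy t : G (y t) by case: (yE t).
have Gy' : gpath y by move=> t _.
have GV g h : G g -> G h -> G (g^-1 * h).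
  by move=> Gg Gh; apply: free_groupM => //; exact: free_groupV.
have uy (t : R) : t \in `[0, 1] -> tcvg \oo (fun k => u k t) (y t).
  move=> t01; have [_ /(_ t01) Nuy] := yE t.
  have Guy k : G ((u k t)^-1 * y t) by apply: GV => //; exact: Gu.
  have uy1 := norm_tcvg1 hN _ Guy Nuy.
  have -> : (fun k => u k t) = fun k => y t * ((u k t)^-1 * y t)^-1.
    apply/funext => k; have ut := free_group_unit (Gu k t t01).
    rewrite invrM ?unitrV // ?free_group_unit // invrK mulrA divrr ?mul1r //.
    exact: free_group_unit.
  rewrite -[X in tcvg _ _ X]mulr1; apply: tcvgM; first exact: tcvg_cst.
  rewrite -[1]invr1; apply: tcvgV => [k||]; [exact: free_group_nil| |exact: uy1].
  by rewrite tcoef_one.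
(* The distance to the limit is bounded by letting j tend to infinity in the Cauchy bound, on each
   pair (s, t), up to an arbitrary r > 0; the strict bound becomes weak. *)
have key (e : R) M : (forall i j, (M <= i)%N -> (M <= j)%N ->
      (d_omega N omega p (u i) (u j) < e%:E)%E) ->
    forall i, (M <= i)%N -> (d_omega N omega p (u i) y <= e%:E)%E.
  move=> uM i Mi; apply/d_omegaP => s t s0 st t1; have [i0 i1] := mem_itv01 s0 st t1.
  have Gi k : G (increment (u k) s t) := gpath_incr (Gu k) i0 i1.
  have Giy : G (increment y s t) := gpath_incr Gy' i0 i1.
  have iy : N ((increment (u j) s t)^-1 * increment y s t) @[j --> \oo] --> 0.
    apply: (tcvg1_norm hN) => [k|]; first exact: GV.
    rewrite -(mulVr (free_group_unit Giy)); apply: tcvgM; last exact: tcvg_cst.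
    apply: tcvgV; [by move=> k; exact: free_group_nil|exact: free_group_nil|].
    apply: tcvgM; last exact: uy.
    apply: tcvgV; last exact: uy.
      by move=> k; apply: free_group_nil; exact: Gu.
    exact: free_group_nil.
  apply/ler_addgt0Pr => r r0.
  have /cvgr0Pnorm_lt/(_ _ r0)[M' _ jr] := iy.
  pose j := maxn M M'.
  apply: le_trans (d_group_tri (Gi i) (Gi j) Giy) _; apply: lerD.
    have /ltW/d_omegaP : (d_omega N omega p (u i) (u j) < e%:E)%E.
      by apply: uM => //; exact: leq_maxl.
    exact.
  apply/ltW/(le_lt_trans (ler_norm _))/jr; exact: leq_maxr.
have [M1 uM1] := cu 1 ltr01.
have y1 : (d_omega N omega p y (fun=> 1%R) < +oo)%E.
  have G1 := @gpath1.
  apply: le_lt_trans (d_omega_tri Gy' (Gu M1) G1) _.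
  apply: lte_add_pinfty; last by case: (Cu M1).
  by rewrite d_omega_sym //; apply: le_lt_trans (key _ _ uM1 M1 (leqnn _)) (ltry _).
have i00 : (0 : R) \in `[0, 1] by rewrite in_itv /= lexx ler01.
exists y.
  split=> //; split=> //.
  - apply/(gnorm_eq0 hN (Gy 0)).
    have [_ /(_ i00)] := yE 0; under eq_fun do rewrite u0 invr1 mul1r.
    move=> Ny; apply: (@cvg_unique _ _ (N (y 0) @[_ --> \oo])) => //.
    exact: cvg_cst.
  (* The constant for continuity is the distance of y to the constant path, finite by [y1]. *)
  - have yfin : d_omega N omega p y (fun=> 1) \is a fin_num.
      by rewrite ge0_fin_numE // d_omega_ge0 //; exact: gpath1.
    apply: (holder_continuous (C := fine (d_omega N omega p y (fun=> 1)))) => //.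
    by move=> s t s0 st t1; apply: d_omega1_norm => //; rewrite fineK.
have d0 n : (0 <= d_omega N omega p (u n) y)%E by exact: d_omega_ge0.
(* Convergence of extended reals: the distances are eventually finite, and their real parts tend to
   0. *)
apply/fine_cvgP; split.
  exists M1 => // n M1n; rewrite ge0_fin_numE //.
  exact: le_lt_trans (key _ _ uM1 n M1n) (ltry _).
apply/cvgr0Pnorm_le => e e0; have [M uM] := cu e e0.
exists M => // n Mn; rewrite /= ger0_norm ?fine_ge0 //.
have de := key _ _ uM n Mn.
by rewrite -lee_fin fineK // ge0_fin_numE // (le_lt_trans de) ?ltry.
Qed.

End RoughPathSpace.

Theorem theorem26 (R : realType) (V : normedVectType R) (m : nat)
    (hm : (1 <= m)%N) (p : R) (hp : 1 <= p)
    (N : ttensor V m -> R) (hN : homogeneous_norm N)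
    (omega : R -> R -> R) (homega : control omega)
    (homega_pos : forall s t : R, 0 <= s -> s < t -> t <= 1 -> 0 < omega s t) :
  metric_on (C_omega N omega p)
    (fun x y => forall t : R, t \in `[0, 1] -> x t = y t)
    (d_omega N omega p)
  /\ complete_on (C_omega N omega p) (d_omega N omega p).
Proof.
by split; [exact: C_omega_metric|exact: C_omega_complete].
Qed.
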